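(* Fix $n\ge2$. For every integer $j\ge2$, define $$F_j(z)=\Big(\sum_{k=1}^n|z_k|^{2j}\Big)^{1/j}+\frac1j\sum_{k=1}^n|z_k|^2,\qquad z\in\mathbb C^n,$$ and set $\Omega_j=\{z\in\mathbb C^n:F_j(z)<1\}$. Then each $\Omega_j$ is a bounded strongly convex domain with smooth boundary, and $$\delta(\Omega_j,K_{\Omega_j})\longrightarrow\infty\qquad (j\to\infty).$$
   Context: Kobayashi distance: for a domain $\Omega\subset\mathbb C^n$, $k_\Omega(z;v)=\inf\{|\lambda|:\lambda\in\mathbb C,\ f:\mathbb D\to\Omega \text{ holomorphic},\ f(0)=z,\ \lambda f'(0)=v\}$, and $K_\Omega(x,y)=\inf_\gamma\int k_\Omega(\gamma;\gamma')\,dt$ over absolutely continuous curves in $\Omega$ from $x$ to $y$ (so $k_{\mathbb D}(\zeta;v)=|v|/(1-|\zeta|^2)$). Hyperbolicity constant: a metric space $(X,d)$ is $\delta$-hyperbolic if $(x\mid z)_o\ge\min\{(x\mid y)_o,(y\mid z)_o\}-\delta$ for all $o,x,y,z\in X$, where $(x\mid y)_o=\frac12(d(x,o)+d(y,o)-d(x,y))$; $\delta(X,d)\in[0,+\infty]$ is the infimum of all such $\delta\ge0$. A domain with smooth boundary is strongly convex if near each boundary point it has a smooth defining function (with nonvanishing gradient on the boundary) whose real Hessian is positive definite. *)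

(* Defs.v *)
From HB Require Import structures.
From mathcomp Require Import all_boot all_order all_algebra complex.
From mathcomp Require Import all_classical all_reals all_analysis.

Set Implicit Arguments.
Unset Strict Implicit.
Unset Printing Implicit Defensive.

Import Order.TTheory GRing.Theory Num.Theory numFieldNormedType.Exports.

Local Open Scope classical_set_scope.
Local Open Scope ring_scope.
Local Open Scope complex_scope.

(* The topology of R[i], hence of C^n = 'rV[R[i]]_n, is the one carried by any
   numFieldType; the instance makes it available on R[i] itself. *)
HB.instance Definition _ (R : rcfType) := NormedModule.copy R[i] R[i]^o.

Definition domain (T : topologicalType) (A : set T) : Prop :=
  [/\ A !=set0, open A & connected A].

Definition boundary (T : topologicalType) (A : set T) : set T :=
  closure A `\` A^°.

Definition partial (R : realType) (m : nat) (a : 'I_m) (r : 'rV[R]_m -> R) :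
    'rV[R]_m -> R :=
  fun x => derive r x (delta_mx 0 a).

(* C^oo on an open set U: all iterated partial derivatives exist and are
   continuous at the points of U. *)
Definition smooth_on (R : realType) (m : nat) (U : set 'rV[R]_m)
    (r : 'rV[R]_m -> R) : Prop :=
  forall (s : seq 'I_m) (x : 'rV[R]_m), U x ->
    let g := foldr (@partial R m) r s in
    {for x, continuous g} /\ forall a : 'I_m, derivable g x (delta_mx 0 a).

Definition gradient (R : realType) (m : nat) (r : 'rV[R]_m -> R)
    (x : 'rV[R]_m) : 'rV[R]_m :=
  \row_a partial a r x.

Definition hessian (R : realType) (m : nat) (r : 'rV[R]_m -> R)
    (x : 'rV[R]_m) : 'M[R]_m :=
  \matrix_(a, b) partial a (partial b r) x.

Definition posdef (R : realType) (m : nat) (H : 'M[R]_m) : Prop :=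
  forall w : 'rV[R]_m, w != 0 -> 0 < (w *m H *m w^T) 0 0.

Definition defining_function (R : realType) (m : nat) (D U : set 'rV[R]_m)
    (r : 'rV[R]_m -> R) : Prop :=
  [/\ smooth_on U r,
      D `&` U = [set x | U x /\ r x < 0] &
      forall x, boundary D x -> U x -> gradient r x != 0].

Definition smooth_boundary (R : realType) (m : nat) (D : set 'rV[R]_m) : Prop :=
  forall p, boundary D p ->
    exists U r, [/\ open U, U p & defining_function D U r].

Definition strongly_convex (R : realType) (m : nat) (D : set 'rV[R]_m) : Prop :=
  forall p, boundary D p ->
    exists U r, [/\ open U, U p, defining_function D U r &
      forall x, U x -> posdef (hessian r x)].

(* R^2n -> C^n, (x, y) |-> x + i y *)
Definition toC (R : realType) (n : nat) (w : 'rV[R]_(n + n)) : 'rV[R[i]]_n :=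
  \row_k (w 0 (lshift n k) +i* w 0 (rshift n k)).

Definition realify (R : realType) (n : nat) (Om : set 'rV[R[i]]_n) :
    set 'rV[R]_(n + n) :=
  @toC R n @^-1` Om.

(* The map f is total, but only its restriction to the open unit disc matters. *)
Definition kobayashi_metric (R : realType) (n : nat) (Om : set 'rV[R[i]]_n)
    (z v : 'rV[R[i]]_n) : \bar R :=
  ereal_inf [set (ComplexField.Normc.normc l)%:E | l in
    [set l : R[i] | exists f : R[i] -> 'rV[R[i]]_n,
      [/\ forall u : R[i], `|u| < 1 -> derivable f u 1,
          forall u : R[i], `|u| < 1 -> Om (f u),
          f 0 = z & l *: derive1 f 0 = v]]].

Definition abs_continuous (R : realType) (K : numFieldType)
    (V : normedModType K) (a b : R) (g : R -> V) : Prop :=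
  forall e : K, 0 < e -> exists2 d : R, 0 < d &
    forall (m : nat) (s t : 'I_m -> R),
      (forall i, [/\ a <= s i, s i <= t i & t i <= b]) ->
      trivIset [set: 'I_m] (fun i => [set` `]s i, t i[]) ->
      \sum_i (t i - s i) < d ->
      \sum_i `|g (t i) - g (s i)| < e.

(* Derivative of a curve in C^n with respect to its real parameter. On an
   absolutely continuous curve it is the actual derivative almost everywhere,
   and its junk values elsewhere do not affect the length below. *)
Definition curve_deriv (R : realType) (n : nat) (g : R -> 'rV[R[i]]_n) (t : R) :
    'rV[R[i]]_n :=
  \row_k (derive1 (fun s : R => complex.Re (g s 0 k)) t +i*
          derive1 (fun s : R => complex.Im (g s 0 k)) t).

Definition kobayashi_length (R : realType) (n : nat) (Om : set 'rV[R[i]]_n)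
    (a b : R) (g : R -> 'rV[R[i]]_n) : \bar R :=
  (\int[lebesgue_measure]_(t in `[a, b])
     kobayashi_metric Om (g t) (curve_deriv g t))%E.

Definition kobayashi_edist (R : realType) (n : nat) (Om : set 'rV[R[i]]_n)
    (x y : 'rV[R[i]]_n) : \bar R :=
  ereal_inf [set L | exists (a b : R) (g : R -> 'rV[R[i]]_n),
    [/\ a <= b, abs_continuous a b g,
        forall t, a <= t <= b -> Om (g t),
        g a = x /\ g b = y & L = kobayashi_length Om a b g]].

(* kobayashi_edist is finite between two points of a domain, so nothing is lost
   by fine there. *)
Definition kobayashi_dist (R : realType) (n : nat) (Om : set 'rV[R[i]]_n)
    (x y : 'rV[R[i]]_n) : R :=
  fine (kobayashi_edist Om x y).

Definition gromov_product (R : realType) (T : Type) (d : T -> T -> R)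
    (o x y : T) : R :=
  (d x o + d y o - d x y) / 2.

Definition gromov_hyperbolic (R : realType) (T : Type) (X : set T)
    (d : T -> T -> R) (delta : R) : Prop :=
  forall o x y z, X o -> X x -> X y -> X z ->
    gromov_product d o x z >=
      Num.min (gromov_product d o x y) (gromov_product d o y z) - delta.

Definition hyperbolicity_constant (R : realType) (T : Type) (X : set T)
    (d : T -> T -> R) : \bar R :=
  ereal_inf [set delta%:E | delta in
    [set delta : R | 0 <= delta /\ gromov_hyperbolic X d delta]].

Definition F (R : realType) (n j : nat) (z : 'rV[R[i]]_n) : R :=
  (\sum_k ComplexField.Normc.normc (z 0 k) ^+ (2 * j)) `^ (j%:R^-1)
  + j%:R^-1 * \sum_k ComplexField.Normc.normc (z 0 k) ^+ 2.

Arguments F {R} n j z.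

Definition Omega (R : realType) (n j : nat) : set 'rV[R[i]]_n :=
  [set z | F n j z < 1].

Arguments Omega R n j : clear implicits.

(* Main.v *)
From HB Require Import structures.
Require Import Defs.
From mathcomp Require Import all_boot all_order all_algebra complex.
From mathcomp Require Import all_classical all_reals all_analysis.
From mathcomp Require Import ring lra measurable_realfun lebesgue_measure.
Import Order.TTheory GRing.Theory Num.Theory numFieldNormedType.Exports.

(* Omega_j lies in the unit polydisc and contains the polydisc of radius c as soon as
   c^2 (1 + 2n/j) <= 1.  Projecting to a coordinate, the Schwarz-Pick lemma bounds the Kobayashi
   distance of Omega_j from below by the Poincare distance of the disc, while holomorphic discs in
   the small polydisc bound it from above.  The points o, y = (+-ca, 0, ...) and
   z, x = (0, +-ca, 0, ...) are thus at distance at most artanh a when they lie on different axes,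
   since the disc u |-> c ((a - u) / (1 - a u), u) joins them, but at distance at least
   2 artanh (ca) when they lie on the same axis.  Hence delta >= 2 artanh (ca) - artanh a, which is
   large when first a is close to 1 and then j is large.

   The Schwarz lemma is derived from Goursat's theorem on a rectangle in logarithmic polar
   coordinates, which gives the mean value property of g(u)/u.  The lower bound on the length of an
   absolutely continuous curve needs its differentiability almost everywhere: its real coordinate
   is a difference of two nondecreasing absolutely continuous functions, whose Stieltjes measures
   have a density with respect to Lebesgue measure.

   The boundary of Omega_j is smooth because F_j is built from polynomials and a real power of a
   positive polynomial; strong convexity is the Cauchy-Schwarz inequality for the first summand of
   F_j together with the strict convexity of the second. *)

Set Implicit Arguments.
Unset Strict Implicit.
Unset Printing Implicit Defensive.

Local Open Scope classical_set_scope.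
Local Open Scope ring_scope.
Local Open Scope complex_scope.

Import ComplexField.Normc.

(** * Absolutely continuous functions *)

(** The distance is an infimum over all absolutely continuous curves, so the lower bound has to
    treat every one of them, while the upper bound only uses explicit discs. Measurability of the
    Kobayashi metric along a curve is never established: both bounds compare lower integrals, and
    exceptional null sets are discarded on the side of a measurable function. In a polydisc the
    distance is the maximum of the Poincare distances of the coordinates, which is not hyperbolic:
    the four points are the corners of a large square whose diagonals are about twice as long as its
    sides. The domains inherit such squares as they fill the polydisc. The logarithmic coordinate
    sends the singularity of g(u)/u to infinity and turns circles into segments of length 2 pi, so
    that a theorem on rectangles suffices. *)

Section AC.
Context {R : realType}.
Implicit Types (h : R -> R) (l : seq (R * R)) (p q : R * R).

Definition nonoverlap p q := (p.2 <= q.1) || (q.2 <= p.1).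

Definition ordered_pair p := p.1 <= p.2.

Definition total_length l := \sum_(p <- l) (p.2 - p.1).

Definition total_increment h l := \sum_(p <- l) `|h p.2 - h p.1|.

(** Lists allow an interval to be replaced by the pieces of a partition, and the weak bound by [e]
    passes to suprema such as the total variation. The domain is the whole line, as for cumulative
    functions. *)
Definition ac h := forall e : R, 0 < e -> exists2 d, 0 < d & forall l,
  all ordered_pair l -> pairwise nonoverlap l -> total_length l < d ->
  total_increment h l <= e.

Lemma total_increment_ge0 h l : 0 <= total_increment h l.
Proof. exact: sumr_ge0. Qed.

Lemma acN h : ac h -> ac (\- h).
Proof.
move=> ach e e0; have [d d0 hd] := ach _ e0; exists d => // l ol dl ll.
rewrite /total_increment; under eq_bigr do rewrite -opprD normrN.
exact: hd.
Qed.

Lemma acD h1 h2 : ac h1 -> ac h2 -> ac (h1 \+ h2).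
Proof.
move=> ac1 ac2 e e0; have e20 : 0 < e / 2 by rewrite divr_gt0.
have [d1 d10 hd1] := ac1 _ e20; have [d2 d20 hd2] := ac2 _ e20.
exists (Num.min d1 d2); first by rewrite lt_min d10.
move=> l ol dl; rewrite lt_min => /andP[l1 l2].
have := lerD (hd1 _ ol dl l1) (hd2 _ ol dl l2); rewrite -splitr.
apply: le_trans; rewrite /total_increment -big_split/=.
by apply: ler_sum => p _; rewrite opprD addrACA ler_normD.
Qed.

Lemma ac_continuous h : ac h -> continuous h.
Proof.
move=> ach x; apply/(@cvgrPdist_le _ R^o) => e e0.
have [d d0 hd] := ach _ e0; near=> y.
have yd : `|x - y| < d.
  by near: y; exact: (@cvgr_dist_lt _ R^o _ _ _ (fun y => y) x cvg_id).
rewrite /=; have [xy|/ltW yx] := leP x y.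
- have := hd [:: (x, y)]; rewrite /total_length /total_increment !big_seq1/=.
  by rewrite distrC; apply => //=; rewrite /ordered_pair ?xy// -(ger0_norm (_ : 0 <= y - x)) ?subr_ge0// distrC.
- have := hd [:: (y, x)]; rewrite /total_length /total_increment !big_seq1/=.
  by apply => //=; rewrite /ordered_pair ?yx// -(ger0_norm (_ : 0 <= x - y)) ?subr_ge0.
Unshelve. all: by end_near. Qed.

Lemma ac_comp_nonexpansive h (c : R -> R) :
  {homo c : x y / x <= y} -> (forall x y, x <= y -> c y - c x <= y - x) ->
  ac h -> ac (h \o c).
Proof.
move=> cnd cne ach e e0; have [d d0 hd] := ach _ e0; exists d => // l ol dl ll.
have -> : total_increment (h \o c) l = total_increment h [seq (c p.1, c p.2) | p <- l].
  by rewrite /total_increment big_map.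
apply: hd.
- by rewrite all_map; apply: sub_all ol => p /=; exact: cnd.
- rewrite pairwise_map; apply: sub_pairwise dl => p q /=.
  by rewrite /nonoverlap/= => /orP[]/cnd ->; rewrite ?orbT.
- apply: le_lt_trans ll; rewrite /total_length big_map big_seq [leRHS]big_seq.
  by apply: ler_sum => p /(allP ol); exact: cne.
Qed.

Fixpoint pairs_of (a : R) (s : seq R) :=
  if s is x :: s' then (a, x) :: pairs_of x s' else [::].

Lemma variation_pairs_of a b h s : itv_partition a b s ->
  variation a b h s = total_increment h (pairs_of a s).
Proof.
elim: s a => [|x s ih] a abs.
  by rewrite variation_nil /total_increment big_nil.
rewrite /total_increment big_cons -/(total_increment _ _) -ih; last exact: itv_partition_cons abs.
by rewrite variation_zip// variation_zip//=; [rewrite big_cons | exact: itv_partition_cons abs].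
Qed.

Lemma total_length_pairs_of a b s : itv_partition a b s ->
  total_length (pairs_of a s) = b - a.
Proof.
elim: s a => [|x s ih] a abs.
  by rewrite /total_length big_nil (itv_partition_nil abs) subrr.
rewrite /total_length big_cons -/(total_length _) ih/=; last exact: itv_partition_cons abs.
by rewrite addrC subrKA.
Qed.

Lemma pairs_of_sub a b s p : itv_partition a b s -> p \in pairs_of a s ->
  [/\ a <= p.1, p.1 <= p.2 & p.2 <= b].
Proof.
elim: s a => [//|x s ih] a abs /=; rewrite inE => /predU1P[->/=|ps].
  have xb := itv_partition_le (itv_partition_cons abs).
  by split => //; case: abs => /= /andP[/ltW].
have [xp pp pb] := ih _ (itv_partition_cons abs) ps; split => //.
by rewrite (le_trans _ xp)//; case: abs => /= /andP[/ltW].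
Qed.

Lemma pairs_of_nonoverlap a b s : itv_partition a b s ->
  pairwise nonoverlap (pairs_of a s).
Proof.
elim: s a => [//|x s ih] a abs /=.
rewrite ih ?andbT; last exact: itv_partition_cons abs.
apply/allP => q /(pairs_of_sub (itv_partition_cons abs))[xq _ _].
by rewrite /nonoverlap/= xq.
Qed.

Lemma total_increment_cat h l1 l2 :
  total_increment h (l1 ++ l2) = total_increment h l1 + total_increment h l2.
Proof. by rewrite /total_increment big_cat. Qed.

Lemma total_length_cat l1 l2 :
  total_length (l1 ++ l2) = total_length l1 + total_length l2.
Proof. by rewrite /total_length big_cat. Qed.

Local Open Scope ereal_scope.

(* The intervals of [l1] are replaced one at a time by the pieces of arbitrary partitions. *)
Lemma ac_total_variation_aux h (d e : R) :
  (forall l, all ordered_pair l -> pairwise nonoverlap l ->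
    (total_length l < d)%R -> (total_increment h l <= e)%R) ->
  forall l1 l2, all ordered_pair (l1 ++ l2) -> pairwise nonoverlap (l1 ++ l2) ->
    (total_length (l1 ++ l2) < d)%R ->
  \sum_(p <- l1) total_variation p.1 p.2 h + (total_increment h l2)%:E <= e%:E.
Proof.
move=> H; elim=> [|p l1 ih] l2 ol dl ll.
  by rewrite big_nil add0e lee_fin; exact: H.
set rest := \sum_(_ <- l1) _ in ih *.
move: ol => /= /andP[op]; rewrite all_cat => /andP[ol1 ol2].
move: dl => /=; rewrite all_cat => /andP[/andP[pl1 pl2]].
rewrite pairwise_cat => /and3P[l12 dl1 dl2].
have rest0 : 0 <= rest + (total_increment h l2)%:E.
  rewrite adde_ge0 ?lee_fin ?total_increment_ge0// /rest big_seq sume_ge0// => q /(allP ol1).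
  exact: total_variation_ge0.
have finrest : rest + (total_increment h l2)%:E \is a fin_num.
  rewrite ge0_fin_numE//; apply: (@le_lt_trans _ _ e%:E); last exact: ltry.
  apply: ih; rewrite ?all_cat ?ol1 ?ol2 ?pairwise_cat ?l12 ?dl1 ?dl2//.
  apply: le_lt_trans ll; rewrite /= /total_length big_cons lerDr subr_ge0.
  exact: op.
rewrite big_cons -/rest -addeA -leeBrDr//.
apply: ge_ereal_sup => _ /= [x [s ps <-] <-].
rewrite leeBrDr// (variation_pairs_of _ ps) addeC -addeA -EFinD -total_increment_cat.
have subp q : nonoverlap p q -> all (nonoverlap^~ q) (pairs_of p.1 s).
  move=> pq; apply/allP => r /(pairs_of_sub ps)[pr _ rp].
  move: pq; rewrite /nonoverlap => /orP[pq|qp].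
    by rewrite (le_trans rp pq).
  by rewrite (le_trans qp pr) orbT.
have nC q r : nonoverlap q r = nonoverlap r q by rewrite /nonoverlap orbC.
apply: ih.
+ rewrite !all_cat ol1 ol2/=; apply/allP => q /(pairs_of_sub ps)[] //.
+ rewrite !pairwise_cat dl1 dl2 (pairs_of_nonoverlap ps)/= allrel_catr l12/=.
  rewrite andbT; apply/andP; split.
    by apply/allrelP => q r ql1 rs; rewrite nC; move/allP : (subp q (allP pl1 _ ql1)); exact.
  apply/allrelP => q r ql2 rs.
  by rewrite nC; move/allP : (subp q (allP pl2 _ ql2)); exact.
+ rewrite !total_length_cat (total_length_pairs_of ps); apply: le_lt_trans ll.
  by rewrite /= /total_length big_cons big_cat/=; lra.
Qed.

(** An interval shorter than [d] has variation at most 1, and [b] is reached from [a] in finitely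
    many steps of length [d / 2]. *)
Lemma ac_total_variation_fin h a b : ac h -> (a <= b)%R ->
  total_variation a b h \is a fin_num.
Proof.
move=> ach ab; have [d d0 hd] := ach _ ltr01.
have small s t : (s <= t)%R -> (t - s < d)%R -> total_variation s t h <= 1%:E.
  move=> st std; have := @ac_total_variation_aux h d 1 hd [:: (s, t)] [::].
  rewrite big_seq1/= /total_increment big_nil adde0; apply => //=.
    by rewrite /ordered_pair/= st.
  by rewrite /total_length big_seq1.
have step (k : nat) t : (a <= t)%R -> (t - a <= k%:R * (d / 2))%R -> total_variation a t h < +oo.
  elim: k t => [|k ih] t at_.
    rewrite mul0r subr_le0 => ta.
    by rewrite (_ : t = a) ?total_variationxx ?ltry//; apply/eqP; rewrite eq_le at_ ta.
  move=> tk; have [tk'|tk'] := leP (t - a)%R (k%:R * (d / 2))%R; first exact: ih.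
  pose s := (a + k%:R * (d / 2))%R.
  have kd0 : (0 <= k%:R * (d / 2))%R by rewrite mulr_ge0// ltW// divr_gt0.
  have as_ : (a <= s)%R by rewrite /s lerDl.
  have st : (s <= t)%R by rewrite /s addrC -lerBrDr ltW.
  rewrite (total_variationD _ as_ st) lte_add_pinfty//.
    by apply: ih => //; rewrite /s addrC addKr.
  apply: (le_lt_trans (small _ _ st _)); rewrite ?ltry//.
  move: tk; rewrite /s -natr1; lra.
rewrite ge0_fin_numE ?total_variation_ge0//.
apply: (step (Num.trunc ((b - a) / (d / 2))).+1) => //.
by rewrite -ler_pdivrMr ?divr_gt0// ltW// truncnS_gt.
Qed.

Let maxnd (a : R) : {homo Num.max a : x y / (x <= y)%R}.
Proof. by move=> x y xy; rewrite ge_max le_max lexx/= le_max xy orbT. Qed.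

Let maxne (a x y : R) : (x <= y)%R -> (Num.max a y - Num.max a x <= y - x)%R.
Proof. by move=> xy; rewrite /Num.max; case: ltP => ay; case: ltP => ax; lra. Qed.

(** [Num.max a t] extends the variation function by a constant to the left of [a]. Its increments
    are variations over subintervals, and [ac_total_variation_aux] bounds their sum with the same
    [d]. *)
Lemma ac_total_variation h a : ac h ->
  ac (fun t => fine (total_variation a (Num.max a t) h)).
Proof.
move=> ach; set V := fun t => _.
have VE s t : (s <= t)%R ->
    (V t - V s)%:E = total_variation (Num.max a s) (Num.max a t) h.
  move=> st; rewrite /V.
  have am u : (a <= Num.max a u)%R by rewrite le_max lexx.
  have mm : (Num.max a s <= Num.max a t)%R by rewrite ge_max am le_max st orbT.
  rewrite (total_variationD _ (am s) mm) fineD ?ac_total_variation_fin//.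
  by rewrite addrC addKr fineK// ac_total_variation_fin.
move=> e e0; have [d d0 hd] := ach _ e0; exists d => // l ol dl ll.
have := @ac_total_variation_aux h d e hd [seq (Num.max a p.1, Num.max a p.2) | p <- l] [::].
rewrite cats0 /total_increment big_nil adde0 big_map => H.
rewrite -lee_fin; apply: le_trans (H _ _ _).
- rewrite -sumEFin big_seq [leRHS]big_seq; apply: lee_sum => p /(allP ol) op.
  rewrite -VE// lee_fin ger0_norm// -lee_fin EFinB -EFinB VE//.
  by rewrite total_variation_ge0//; exact: maxnd.
- rewrite all_map; apply: sub_all ol => p /= op.
  exact: maxnd op.
- rewrite pairwise_map; apply: sub_pairwise dl => p q /=.
  by rewrite /nonoverlap/= => /orP[]/maxnd ->; rewrite ?orbT.
- apply: le_lt_trans ll; rewrite /total_length big_map big_seq [leRHS]big_seq.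
  by apply: ler_sum => p /(allP ol); exact: maxne.
Qed.

End AC.

(** * Stieltjes measures of absolutely continuous functions *)

Section stieltjes.
Context {R : realType}.
Variable F : cumulative R R.
Notation mu := (@lebesgue_measure R).
Notation nu := (lebesgue_stieltjes_measure F).
Local Open Scope ereal_scope.

Lemma stieltjes_itv (a b : R) : (a <= b)%R -> nu `]a, b] = (F b - F a)%:E.
Proof.
move=> ab; rewrite /lebesgue_stieltjes_measure /measure_extension/=.
by rewrite measurable_mu_extE/= ?wlength_itv_bnd//; exact: is_ocitv.
Qed.

(** Lets the components of an open set form a list of pairs to which [ac] applies. *)
Lemma disjoint_itv_nonoverlap (I J : set R) : is_interval I -> is_interval J ->
  I !=set0 -> J !=set0 -> has_ubound I -> has_ubound J -> has_lbound I -> has_lbound J ->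
  I `&` J = set0 ->
  nonoverlap (inf I, sup I) (inf J, sup J).
Proof.
move=> iI iJ.
wlog: I J iI iJ / exists x y, [/\ I x, J y & (x <= y)%R].
  move=> wl [x Ix] [y Jy] *; have [xy|/ltW yx] := leP x y.
    by apply: wl => //; [exists x, y | exists x | exists y].
  rewrite /nonoverlap/= orbC; apply: (wl J I) => //; [by exists y, x| by exists y|by exists x|].
  by rewrite setIC.
move=> [x [y [Ix Jy xy]]] I0 J0 uI uJ lI lJ IJ0.
have IJ z : I z -> J z -> False by move=> Iz Jz; suff : set0 z by []; rewrite -IJ0.
apply/orP; left => /=; apply: ge_sup => // u Iu; apply: lb_le_inf => // v Jv.
rewrite leNgt; apply/negP => vu.
have [xv|vx] := leP x v.
  by apply: (IJ v) => //; apply: (iI x u) => //; rewrite xv ltW.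
by apply: (IJ x) => //; apply: (iJ v y) => //; rewrite xy ltW.
Qed.

(** A null set lies in an open set of length less than [d]. Finitely many components of it have
    total length below [d], so their increments sum to at most [e], and countable additivity carries
    this bound to the measure of the open set. *)
Lemma ac_stieltjes_dominated : ac F -> nu `<< mu.
Proof.
move=> acF; apply/null_content_dominatesP => N mN muN0.
(* Boundedness gives all components finite end points. *)
wlog [M NM] : N mN muN0 / exists M : R, N `<=` `]- M, M[%classic%R.
  move=> wl; have -> : N = \bigcup_k (N `&` `](- k%:R), k%:R[%classic%R).
    rewrite -setI_bigcupr; apply/esym/setIidl => x _.
    exists (Num.truncn `|x|).+1 => //=; rewrite in_itv/= -ltr_norml.
    exact: truncnS_gt.
  have mNk k : measurable (N `&` `](- k%:R), k%:R[%classic%R) by exact: measurableI.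
  apply/eqP; rewrite -measure_le0.
  apply: le_trans (measure_sigma_subadditive _ _ _ (@subset_refl _ _)) _ => //.
    exact: bigcup_measurable.
  rewrite eseries0// => k _ _; apply: wl => //.
    by apply: (subset_measure0 _ _ _ muN0) => //; exact: subIsetl.
  by exists k%:R%R; exact: subIsetr.
apply/eqP; rewrite -measure_le0; apply/lee_addgt0Pr => e e0; rewrite add0e.
have [d d0 hd] := acF _ e0.
have [U0 [oU0 NU0 muU0]] : exists U, [/\ open U, N `<=` U & mu U < d%:E].
  have muNoo : mu N < +oo by rewrite muN0 ltry.
  have [U [oU NU UNd]] := lebesgue_regularity_outer mN muNoo d0.
  exists U; split => //; rewrite -(setDUK NU).
  rewrite measureU//; last 2 first.
    apply: measurableD => //; exact: open_measurable.
    exact: setDIK.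
  by rewrite muN0 add0e.
pose U := U0 `&` `](- M), M[%classic%R.
have oU : open U by apply: openI => //; exact: interval_open.
have NU : N `<=` U by move=> x Nx; split; [exact: NU0 | exact: NM].
have mU : measurable U by exact: open_measurable.
have muU : mu U < d%:E.
  apply: le_lt_trans muU0; apply: le_measure; rewrite ?inE//; last exact: subIsetl.
  exact: open_measurable.
pose J := open_disjoint_itv oU.
have oJ i : open (J i) by exact: open_disjoint_itv_open.
have mJ i : measurable (J i) by exact: open_measurable.
have UE : U = \bigcup_q J q by exact: open_disjoint_itv_bigcup.
have JU i : J i `<=` U by move=> x Jx; rewrite UE; exists i.
have ubJ i : has_ubound (J i).
  by exists M => x /JU [_ /=]; rewrite in_itv/= => /andP[_ /ltW].
have lbJ i : has_lbound (J i).
  by exists (- M)%R => x /JU [_ /=]; rewrite in_itv/= => /andP[/ltW].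
have iJ i : is_interval (J i) by exact: open_disjoint_itv_is_interval.
have tJ : trivIset setT J by exact: open_disjoint_itv_trivIset.
have nuJ i : J i !=set0 -> nu (J i) <= (F (sup (J i)) - F (inf (J i)))%:E.
  move=> J0; rewrite -stieltjes_itv; last first.
    by case: J0 => x Jx; apply: (@le_trans _ _ x); [exact: ge_inf|exact: ub_le_sup].
  have m1 : measurable (`]inf (J i), sup (J i)]%classic%R : set R) by exact: measurable_itv.
  apply: le_measure; [exact: (mem_set (mJ i))|exact: (mem_set m1)|].
  move=> x Jx; rewrite /= in_itv/= ub_le_sup// andbT lt_neqAle ge_inf// andbT.
  (* An open interval does not contain its infimum, so the half-open interval covers it. *)
  apply/eqP => xE; have := oJ i; rewrite openE => /(_ _ Jx) /nbhs_ballP[r /= r0 rJ].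
  have : J i (x - r / 2)%R.
    apply: rJ; rewrite /ball/= opprB addrC subrK gtr0_norm ?divr_gt0//.
    by rewrite ltr_pdivrMr// ltr_pMr// ltr1n.
  move/(ge_inf (lbJ i)); rewrite xE; have : (0 < r / 2)%R by rewrite divr_gt0.
  lra.
have muJ i : J i !=set0 -> (sup (J i) - inf (J i))%:E <= mu (J i).
  move=> J0; have : `]inf (J i), sup (J i)[%classic%R `<=` J i.
    move=> x /=; rewrite in_itv/= => /andP[ix xs].
    have [y Jy yx] := inf_lt J0 ix.
    have [z Jz xz] := sup_gt J0 xs.
    by apply: (iJ i y z) => //; rewrite !ltW.
  move=> sub; apply: (@le_trans _ _ (mu `]inf (J i), sup (J i)[%classic%R)); last first.
    have m1 : measurable (`]inf (J i), sup (J i)[%classic%R : set R) by exact: measurable_itv.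
    by apply: le_measure => //; [exact: (mem_set m1)|exact: (mem_set (mJ i))].
  rewrite lebesgue_measure_itv/= lte_fin; case: ifPn => // ns.
  by rewrite lee_fin subr_le0 leNgt.
apply: (@le_trans _ _ (nu U)); first by apply: le_measure; rewrite ?inE.
rewrite UE measure_bigcup//=.
rewrite (eq_eseriesl (Q := xpredT)); last by move=> i; rewrite in_setT.
apply: lime_le; first by apply: is_cvg_nneseries => *; exact: measure_ge0.
near=> n.
(* Empty components are dropped: their [inf] and [sup] are default values, which could overlap
   another interval. *)
pose S := [seq i <- index_iota 0 n | J i != set0].
pose l := [seq (inf (J i), sup (J i)) | i <- S].
have SJ i : i \in S -> J i !=set0 by rewrite mem_filter => /andP[/set0P].
apply: (@le_trans _ _ (total_increment F l)%:E); last rewrite lee_fin.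
  rewrite /total_increment big_map -sumEFin big_filter.
  rewrite (bigID (fun i => J i != set0))/= [X in _ + X]big1 ?adde0; last first.
    by move=> i; rewrite negbK => /eqP ->; rewrite measure0.
  apply: lee_sum => i /set0P J0; apply: le_trans (nuJ _ J0) _.
  by rewrite lee_fin ler_norm.
apply: hd.
- rewrite all_map; apply/allP => i /SJ [x Jx] /=.
  rewrite /ordered_pair/=; apply: (@le_trans _ _ x); [exact: ge_inf|exact: ub_le_sup].
- rewrite pairwise_map; apply: (@sub_in_pairwise _ (mem S) (fun i j => i != j)); last first.
  + by rewrite -uniq_pairwise filter_uniq// iota_uniq.
  + exact/allP.
  + move=> i j /SJ Ji /SJ Jj ij /=; apply: disjoint_itv_nonoverlap => //.
    by move/trivIsetP : tJ; exact.
- rewrite -lte_fin; apply: le_lt_trans muU.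
  apply: (@le_trans _ _ (\sum_(i <- S) mu (J i))).
    rewrite /total_length big_map -sumEFin big_seq [leRHS]big_seq; apply: lee_sum => i /SJ.
    exact: muJ.
  have -> : \sum_(i <- S) mu (J i) = \sum_(0 <= i < n) mu (J i).
    rewrite big_filter [RHS](bigID (fun i => J i != set0))/= [X in _ = _ + X]big1 ?adde0//.
    by move=> i; rewrite negbK => /eqP ->; rewrite measure0.
  rewrite UE measure_bigcup//=.
  rewrite (eq_eseriesl (Q := xpredT)); last by move=> i; rewrite in_setT.
  by apply: nneseries_lim_ge => *; exact: measure_ge0.
Unshelve. all: try by end_near.
all: by move=> i _; have := mJ i.
Qed.

End stieltjes.

Section ac_integral.
Context {R : realType}.
Notation mu := (@lebesgue_measure R).

(** The Stieltjes measure is restricted to ]a, b], where it is finite, so that its Radon-Nikodym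
    density is integrable. *)
Lemma ac_cumulative_density (F : cumulative R R) (a b : R) : ac F -> a <= b ->
  exists g : R -> R, mu.-integrable setT (EFin \o g) /\
    forall x, a <= x <= b -> F x - F a = \int[mu]_(t in `]a, x]) g t.
Proof.
move=> acF ab; pose nu := lebesgue_stieltjes_measure F.
have mab : measurable (`]a, b]%classic : set (measurableTypeR R)) by exact: measurable_itv.
have nuab : (nu `]a, b]%classic < +oo)%E.
  have -> : nu `]a, b]%classic = (F b - F a)%:E by exact: stieltjes_itv.
  exact: ltry.
have numu : mfrestr mab nuab `<< mu.
  apply/null_content_dominatesP => N mN muN0; rewrite /mfrestr /mrestr.
  have := ac_stieltjes_dominated acF; move/null_content_dominatesP => H.
  apply: H; first exact: measurableI.
  apply: (subset_measure0 _ _ _ muN0) => //; exact: (measurableI _ _ mN mab).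
have [f [f0 ffin intf fE]] := @radon_nikodym_sigma_finite _ _ _ (@lebesgue_measure R) (mfrestr mab nuab) numu.
have fEF : f = EFin \o (fine \o f) by apply/funext => x /=; rewrite fineK.
exists (fine \o f); split; first by rewrite -fEF.
move=> x /andP[ax xb].
have mx : measurable (`]a, x]%classic : set (measurableTypeR R)) by exact: measurable_itv.
rewrite /Rintegral; have <- : (\int[mu]_(t in `]a, x]) f t = \int[mu]_(t in `]a, x]) ((fine \o f) t)%:E)%E.
  by apply: eq_integral => t _ /=; rewrite fineK.
have : (nu (`]a, x]%classic `&` `]a, b]%classic) = \int[mu]_(t in `]a, x]) f t)%E by exact: fE.
rewrite setIidl; last by move=> t /=; rewrite !in_itv/= => /andP[-> /le_trans]; exact.
move=> <-; rewrite (_ : nu `]a, x]%classic = (F x - F a)%:E)//.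
exact: stieltjes_itv.
Qed.

Lemma ac_nondecreasing_density (F : R -> R) (a b : R) : {homo F : x y / x <= y} ->
  ac F -> a <= b ->
  exists g : R -> R, mu.-integrable setT (EFin \o g) /\
    forall x, a <= x <= b -> F x - F a = \int[mu]_(t in `]a, x]) g t.
Proof.
move=> ndF acF.
have rcF : right_continuous F by apply/right_continuousW/ac_continuous.
pose G := isCumulative.Build R _ R F ndF rcF.
pose C : cumulative R R := HB.pack F G.
exact: (@ac_cumulative_density C).
Qed.

(** Jordan decomposition: [V] and [V - h1] are nondecreasing and absolutely continuous, and the
    density of [h] on [a, b] is the difference of theirs. *)
Lemma ac_density (h : R -> R) (a b : R) : ac h -> a <= b ->
  exists g : R -> R, mu.-integrable setT (EFin \o g) /\
    forall x, a <= x <= b -> h x - h a = \int[mu]_(t in `]a, x]) g t.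
Proof.
move=> ach ab.
pose m := Num.max a; pose h1 := h \o m; pose V t := fine (total_variation a (m t) h).
have mnd : {homo m : x y / x <= y}.
  by move=> x y xy; rewrite ge_max le_max lexx/= le_max xy orbT.
have mne x y : x <= y -> m y - m x <= y - x.
  by move=> xy; rewrite /m /Num.max; case: ltP => ay; case: ltP => ax; lra.
have ach1 : ac h1 by exact: ac_comp_nonexpansive.
have acV : ac V by exact: ac_total_variation.
have am x : a <= m x by rewrite /m le_max lexx.
have TVD s t : s <= t -> V t - V s >= `|h1 t - h1 s|.
  move=> st; rewrite -lee_fin EFinB /V !fineK ?ac_total_variation_fin//.
  rewrite (total_variationD _ (am s) (mnd _ _ st)) addeAC subee ?ac_total_variation_fin// add0e.
  exact/total_variation_ge/mnd.
have [g1 [ig1 g1E]] : exists g : R -> R, mu.-integrable setT (EFin \o g) /\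
    forall x, a <= x <= b -> V x - V a = \int[mu]_(t in `]a, x]) g t.
  apply: ac_nondecreasing_density => // s t st.
  by rewrite -subr_ge0 (le_trans _ (TVD _ _ st)).
have [g2 [ig2 g2E]] : exists g : R -> R, mu.-integrable setT (EFin \o g) /\
    forall x, a <= x <= b -> (V \- h1) x - (V \- h1) a = \int[mu]_(t in `]a, x]) g t.
  apply: ac_nondecreasing_density => //.
    move=> s t st /=; have := le_trans (ler_norm _) (TVD _ _ st); lra.
  by apply: acD => //; exact: acN.
exists (g1 \- g2); split.
  rewrite (_ : EFin \o _ = (EFin \o g1) \- (EFin \o g2))%E; last by apply/funext => x.
  exact: integrableB.
move=> x xab; rewrite RintegralB//; try by apply: integrableS _ _ (subsetT _) _.
rewrite -g1E// -g2E//= /h1/= /m.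
have /andP[ax xb] := xab.
by rewrite (max_idPr ax) maxxx; ring.
Qed.

(** Lebesgue differentiation of the indefinite integral of the density. *)
Lemma ac_ae_derivable (h : R -> R) (a b : R) : ac h -> a <= b ->
  exists g : R -> R, [/\ mu.-integrable setT (EFin \o g),
    h b - h a = \int[mu]_(t in `]a, b]) g t &
    {ae mu, forall x, a < x < b -> derivable h x 1 /\ derive1 h x = g x}].
Proof.
move=> ach ab; have [g [ig gE]] := ac_density ach ab.
exists g; split => //; first by apply: gE; rewrite ab lexx.
have locg : locally_integrable setT g.
  by apply: open_integrable_locally => //; exact: openT.
have := @FTC1 _ g (BRight a) _ locg.
have H y : mu.-integrable [set` Interval (BRight a) (BRight y)] (EFin \o g).
  by apply: integrableS _ _ (subsetT _) _.
move=> /(_ H); apply: filterS; first exact: (ae_filter_ringOfSetsType mu).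
move=> x /= K /andP[ax xb].
pose G y := \int[mu]_(t in `]a, y]) g t.
have [dG GE] : derivable G x 1 /\ derive1 G x = g x by apply: K; rewrite lte_fin.
have near_hG : \forall y \near x, h a + G y = h y.
  have : \forall y \near x, y \in `]a, b[.
    by apply: near_in_itvoo; rewrite in_itv/= ax xb.
  apply: filterS => y; rewrite in_itv/= => /andP[ay yb].
  by rewrite /G/= -gE ?(ltW ay) ?(ltW yb)//; ring.
have dhG : is_derive x 1 (fun y => h a + G y) (g x).
  have -> : g x = 0 + g x by rewrite add0r.
  apply: is_deriveD; split => //; by rewrite -derive1E.
have [dh hE] := near_eq_is_derive near_hG dhG.
by split => //; rewrite derive1E.
Qed.

End ac_integral.

Section lower_integral.
Import HBNNSimple.

(* The integral of a nonnegative function is defined as a lower integral. *)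
Lemma le_lower_integral d (T : measurableType d) (R : realType)
    (mu : {measure set T -> \bar R}) (D E : set T) (f g : T -> \bar R) :
  (forall x, D x -> 0 <= f x)%E -> (forall x, E x -> 0 <= g x)%E ->
  (forall x, D x -> E x /\ (f x <= g x)%E) ->
  (\int[mu]_(x in D) f x <= \int[mu]_(x in E) g x)%E.
Proof.
move=> f0 g0 fg; rewrite !ge0_integralE//.
apply: ge_ereal_sup => _ /= [s sf <-]; apply: ereal_sup_ubound; exists s => // x. apply: le_trans (sf x) _; rewrite !patchE.
case: ifPn => [/set_mem/fg[Ex fgx]|_]; first by rewrite mem_set.
by case: ifPn => // /set_mem /g0.
Qed.

End lower_integral.

Section ac_le_integral.
Context {R : realType}.
Notation mu := (@lebesgue_measure R).

Lemma ac_increment_le_integral (h : R -> R) (a b : R) (phi : R -> \bar R) :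
  ac h -> a <= b -> (forall x, 0 <= phi x)%E ->
  (forall x, a < x < b -> derivable h x 1 -> (`|derive1 h x|%:E <= phi x)%E) ->
  ((h b - h a)%:E <= \int[mu]_(t in `[a, b]) phi t)%E.
Proof.
move=> ach ab phi0 hphi; have [g [ig hE [N [mN muN0 NP]]]] := ac_ae_derivable ach ab.
have igab : mu.-integrable `]a, b[ (EFin \o g).
  by apply: integrableS _ _ (subsetT _) _.
have mg : measurable_fun (`]a, b[%classic : set R) (EFin \o g).
  by case/integrableP : igab.
have maN : measurable (`]a, b[ `\` N : set R) by exact: measurableD.
have -> : (h b - h a)%:E = (\int[mu]_(t in `]a, b[) (g t)%:E)%E.
  have fin : (\int[mu]_(t in `]a, b]) (g t)%:E \is a fin_num)%E.
    by apply: integrable_fin_num => //; apply: integrableS _ _ (subsetT _) _.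
  by rewrite hE /Rintegral fineK// integral_itv_bndo_bndc.
apply: (@le_trans _ _ (\int[mu]_(t in `]a, b[) `|(EFin \o g) t|)%E).
  by apply: (le_trans (lee_abs _)); exact: le_abse_integral.
(* The null set is removed while the integrand is still the measurable [g]; the comparison with
   [phi] then holds at every remaining point. *)
rewrite (@ge0_negligible_integral _ _ _ mu _ N)//; last exact: measurableT_comp.
apply: le_lower_integral => // x [/= + Nx].
rewrite in_itv/= => axb.
have [dh hg] : derivable h x 1 /\ derive1 h x = g x.
  apply: contrapT => H; apply: Nx; apply: NP => /= K; apply: H; exact: K.
split; first by rewrite in_itv/= !ltW//; case/andP: axb.
by rewrite -hg; exact: hphi.
Qed.

End ac_le_integral.

(** * Goursat's theorem and the Schwarz-Pick lemma *)

Section primitives.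
Context {R : realType}.
Implicit Types (f df G : R -> R) (a b K : R).

Lemma increment_le_derive_bound f df a b K : a <= b ->
  (forall x, a <= x <= b -> is_derive x 1 f (df x)) ->
  (forall x, a <= x <= b -> `|df x| <= K) -> `|f b - f a| <= K * (b - a).
Proof.
move=> ab fdf dfK; have [x||c cab ->] := @MVT_segment R f df a b ab.
- by rewrite in_itv/= => /andP[ax xb]; apply: fdf; rewrite !ltW.
- apply: derivable_within_continuous => x; rewrite in_itv/= => xab.
  by case: (fdf _ xab).
- rewrite normrM [`|b - a|]ger0_norm ?subr_ge0// ler_wpM2r ?subr_ge0//.
  by apply: dfK; rewrite in_itv/= in cab.
Qed.

Lemma continuous_primitive f a b : (forall x, a <= x <= b -> {for x, continuous f}) ->
  exists G, forall x, a < x < b -> is_derive x 1 G (f x).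
Proof.
move=> cf; exists (fun x => \int[lebesgue_measure]_(t in `[a, x]) f t).
move=> x /andP[ax xb].
have [] := @continuous_FTC1 R f (BLeft a) x b xb.
- apply: continuous_compact_integrable; first exact: segment_compact.
  apply: continuous_in_subspaceT => y; rewrite inE/= in_itv/=; exact: cf.
- by rewrite lte_fin.
- by apply: cf; rewrite !ltW.
by move=> dG GE; split => //; rewrite -derive1E.
Qed.

End primitives.

(** * Goursat's theorem on rectangles *)

Section goursat.
Context {R : realType}.
Variables P Q : R -> R -> R.

Definition affine_approx (U : R -> R -> R) (x0 y0 p q e r : R) := forall x y,
  `|x - x0| < r -> `|y - y0| < r ->
  `|U x y - (U x0 y0 + p * (x - x0) + q * (y - y0))| <= e * (`|x - x0| + `|y - y0|).

(** The shared coefficient [q] says dP/dy = dQ/dx. Only differentiability at the point is asked, not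
    continuity of the partial derivatives, which is the strength of Goursat's theorem. *)
Definition closed_at x0 y0 := exists p q q',
  forall e, 0 < e -> exists2 r, 0 < r &
    affine_approx P x0 y0 p q e r /\ affine_approx Q x0 y0 q q' e r.

(* [Phi y] and [Psi x] are primitives of [P] and [Q] along horizontal and vertical lines,
   so that [circulation] is the integral of P dx + Q dy along the boundary of a rectangle. *)
Variables Phi Psi : R -> R -> R.

Definition circulation a b c d :=
  (Phi c b - Phi c a) + (Psi b d - Psi b c) - (Phi d b - Phi d a) - (Psi a d - Psi a c).

(** The affine parts have zero circulation because they share [q]. Each side contributes an error of
    at most [e * s] times its length, where [s] is half the perimeter, and the four lengths add up
    to [2 * s]. *)
Lemma circulation_approx (x0 y0 p q q' e r a b c d : R) : 0 <= e ->
  (forall x y, a <= x <= b -> c <= y <= d -> is_derive x 1 (Phi y) (P x y)) ->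
  (forall x y, a <= x <= b -> c <= y <= d -> is_derive y 1 (Psi x) (Q x y)) ->
  affine_approx P x0 y0 p q e r -> affine_approx Q x0 y0 q q' e r ->
  a <= x0 <= b -> c <= y0 <= d -> b - a < r -> d - c < r ->
  `|circulation a b c d| <= 2 * e * ((b - a) + (d - c)) ^+ 2.
Proof.
move=> e0 dPhi dPsi aP aQ /andP[ax xb] /andP[cy yd] bar dcr.
have ab : a <= b by exact: le_trans xb.
have cd : c <= d by exact: le_trans yd.
set s := (b - a) + (d - c).
have nx x : a <= x <= b -> `|x - x0| <= b - a.
  by move=> /andP[? ?]; rewrite ler_norml; lra.
have ny y : c <= y <= d -> `|y - y0| <= d - c.
  by move=> /andP[? ?]; rewrite ler_norml; lra.
have hor y : c <= y <= d -> `|Phi y b - Phi y a -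
    ((P x0 y0 + q * (y - y0)) * (b - a) + p * ((b - x0) ^+ 2 - (a - x0) ^+ 2) / 2)|
    <= e * s * (b - a).
  move=> ycd.
  pose L x := (P x0 y0 + q * (y - y0)) * x + p * (x - x0) ^+ 2 / 2.
  have dL (x : R) : is_derive x 1 L (P x0 y0 + q * (y - y0) + p * (x - x0)).
    rewrite /L; apply: is_derive_eq; rewrite /GRing.scale/=; by field.
  have := @increment_le_derive_bound _ (Phi y \- L) (fun x => P x y - (P x0 y0 + q * (y - y0) + p * (x - x0))) a b (e * s) ab.
  rewrite /L/= (_ : _ - _ - (_ - _) = Phi y b - Phi y a -
    ((P x0 y0 + q * (y - y0)) * (b - a) + p * ((b - x0) ^+ 2 - (a - x0) ^+ 2) / 2)); last by field.
  apply => x xab; first by apply: is_deriveB; exact: dPhi.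
  rewrite (addrAC (P x0 y0)); apply: le_trans (aP _ _ _ _) _.
  - exact: le_lt_trans (nx _ xab) bar.
  - exact: le_lt_trans (ny _ ycd) dcr.
  - by rewrite ler_wpM2l// lerD ?nx ?ny.
have ver x : a <= x <= b -> `|Psi x d - Psi x c -
    ((Q x0 y0 + q * (x - x0)) * (d - c) + q' * ((d - y0) ^+ 2 - (c - y0) ^+ 2) / 2)|
    <= e * s * (d - c).
  move=> xab.
  pose L y := (Q x0 y0 + q * (x - x0)) * y + q' * (y - y0) ^+ 2 / 2.
  have dL (y : R) : is_derive y 1 L (Q x0 y0 + q * (x - x0) + q' * (y - y0)).
    rewrite /L; apply: is_derive_eq; rewrite /GRing.scale/=; by field.
  have := @increment_le_derive_bound _ (Psi x \- L) (fun y => Q x y - (Q x0 y0 + q * (x - x0) + q' * (y - y0))) c d (e * s) cd.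
  rewrite /L/= (_ : _ - _ - (_ - _) = Psi x d - Psi x c -
    ((Q x0 y0 + q * (x - x0)) * (d - c) + q' * ((d - y0) ^+ 2 - (c - y0) ^+ 2) / 2)); last by field.
  apply => y ycd; first by apply: is_deriveB; exact: dPsi.
  apply: le_trans (aQ _ _ _ _) _.
  - exact: le_lt_trans (nx _ xab) bar.
  - exact: le_lt_trans (ny _ ycd) dcr.
  - by rewrite ler_wpM2l// lerD ?nx ?ny.
have Hc := hor c _; have Hd := hor d _; have Ha := ver a _; have Hb := ver b _.
rewrite /circulation.
rewrite !lexx ?ab ?cd in Hc Hd Ha Hb.
move: (Hc isT) (Hd isT) (Ha isT) (Hb isT); rewrite !ler_norml.
have -> : 2 * e * s ^+ 2 = 2 * (e * s * (b - a)) + 2 * (e * s * (d - c)).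
  by rewrite /s; ring.
move: (e * s * _) (e * s * _) => E1 E2.
by move=> /andP[? ?] /andP[? ?] /andP[? ?] /andP[? ?]; apply/andP; split; lra.
Qed.

(** Repeated quartering: some quarter keeps at least a fourth of the absolute circulation. The
    nested quarters share a point, and there [circulation_approx] makes the n-th circulation small
    compared with 4 ^ -n. *)
Lemma circulation_eq0 (a b c d : R) : a <= b -> c <= d ->
  (forall x y, a <= x <= b -> c <= y <= d -> is_derive x 1 (Phi y) (P x y)) ->
  (forall x y, a <= x <= b -> c <= y <= d -> is_derive y 1 (Psi x) (Q x y)) ->
  (forall x y, a <= x <= b -> c <= y <= d -> closed_at x y) ->
  circulation a b c d = 0.
Proof.
move=> ab cd dPhi dPsi PQ.
pose w n := (b - a) / 2 ^+ n; pose h n := (d - c) / 2 ^+ n.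
have w0 n : 0 <= w n by rewrite divr_ge0 ?subr_ge0// exprn_ge0.
have h0 n : 0 <= h n by rewrite divr_ge0 ?subr_ge0// exprn_ge0.
have wS n : w n = w n.+1 + w n.+1 by rewrite /w exprS; field; rewrite expf_neq0.
have hS n : h n = h n.+1 + h n.+1 by rewrite /h exprS; field; rewrite expf_neq0.
pose J n (z : R * R) := circulation z.1 (z.1 + w n) z.2 (z.2 + h n).
have step (n : nat) (z : R * R) : exists z' : R * R,
    [/\ z.1 <= z'.1, z'.1 + w n.+1 <= z.1 + w n, z.2 <= z'.2, z'.2 + h n.+1 <= z.2 + h n &
        `|J n z| <= 4 * `|J n.+1 z'|].
  pose z1 := (z.1, z.2); pose z2 := (z.1 + w n.+1, z.2).
  pose z3 := (z.1, z.2 + h n.+1); pose z4 := (z.1 + w n.+1, z.2 + h n.+1).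
  (* Inner edges cancel, since adjacent quarters use the same primitives. *)
  have JE : J n z = J n.+1 z1 + J n.+1 z2 + J n.+1 z3 + J n.+1 z4.
    by rewrite /J /circulation/= wS hS !addrA; ring.
  have := w0 n.+1; have := h0 n.+1; have := wS n; have := hS n => ? ? ? ?.
  suff : exists2 z', z' \in [:: z1; z2; z3; z4] & `|J n z| <= 4 * `|J n.+1 z'|.
    move=> [z']; rewrite !inE => /or4P[] /eqP -> Jz; [exists z1 | exists z2 | exists z3 | exists z4];
      by split => //=; lra.
  apply: contrapT => /forall2NP H.
  have H' z' : z' \in [:: z1; z2; z3; z4] -> 4 * `|J n.+1 z'| < `|J n z|.
    by move=> zz'; have [|/negP] := H z' => //; rewrite -ltNge.
  have := H' z1; have := H' z2; have := H' z3; have := H' z4.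
  rewrite !inE !eqxx ?orbT => /(_ isT) ? /(_ isT) ? /(_ isT) ? /(_ isT) ?.
  have : `|J n z| <= `|J n.+1 z1| + `|J n.+1 z2| + `|J n.+1 z3| + `|J n.+1 z4|.
    by rewrite JE !(le_trans (ler_normD _ _))// lerD2r !(le_trans (ler_normD _ _))// lerD2r ler_normD.
  lra.
have /choice[f fP] : forall nz : nat * (R * R), exists z', 
    [/\ nz.2.1 <= z'.1, z'.1 + w nz.1.+1 <= nz.2.1 + w nz.1, nz.2.2 <= z'.2,
        z'.2 + h nz.1.+1 <= nz.2.2 + h nz.1 & `|J nz.1 nz.2| <= 4 * `|J nz.1.+1 z'|].
  by move=> [n z]; exact: step.
pose fix z n := if n is m.+1 then f (m, z m) else (a, c).
have zP n : [/\ (z n).1 <= (z n.+1).1, (z n.+1).1 + w n.+1 <= (z n).1 + w n,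
   (z n).2 <= (z n.+1).2, (z n.+1).2 + h n.+1 <= (z n).2 + h n &
   `|J n (z n)| <= 4 * `|J n.+1 (z n.+1)|] by exact: (fP (n, z n)).
have nested (u v : nat -> R) : (forall n, u n <= u n.+1) -> (forall n, v n.+1 <= v n) ->
    (forall n, u n <= v n) -> exists x, forall n, u n <= x <= v n.
  move=> uS vS uv.
  have uh n m : (n <= m)%N -> u n <= u m by apply: (@homo_leq _ u <=%R) => //; exact: le_trans.
  have vh n m : (n <= m)%N -> v m <= v n.
    by apply: (@homo_leq _ v (fun x y => y <= x)) => // y x t xy yt; exact: le_trans yt xy.
  have uv' n m : u n <= v m.
    by rewrite (le_trans (uh _ _ (leq_maxl n m)))// (le_trans (uv _))// vh// leq_maxr.
  exists (sup (range u)) => n; apply/andP; split.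
    by apply: ub_le_sup; [exists (v 0%N) => _ [m _ <-] | exists n].
  by apply: ge_sup; [exists (u 0%N), 0%N | move=> _ [m _ <-]].
have [x0 x0P] : exists x, forall n, (z n).1 <= x <= (z n).1 + w n.
  by apply: nested => n; [case: (zP n)|case: (zP n)|rewrite lerDl].
have [y0 y0P] : exists x, forall n, (z n).2 <= x <= (z n).2 + h n.
  by apply: nested => n; [case: (zP n)|case: (zP n)|rewrite lerDl].
have Jn n : `|circulation a b c d| <= 4 ^+ n * `|J n (z n)|.
  elim: n => [|n ih].
    by rewrite expr0 mul1r /J /w /h/= expr0 !divr1 !subrKC.
  apply: (le_trans ih); rewrite exprSr -mulrA ler_wpM2l ?exprn_ge0//.
  by case: (zP n).
have za n : a <= (z n).1 /\ (z n).1 + w n <= b.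
  elim: n => [|n [ih1 ih2]]; first by rewrite /w/= expr0 divr1 subrKC.
  by have [H1 H2 _ _ _] := zP n; split; [exact: le_trans H1 | exact: le_trans ih2].
have zc n : c <= (z n).2 /\ (z n).2 + h n <= d.
  elim: n => [|n [ih1 ih2]]; first by rewrite /h/= expr0 divr1 subrKC.
  by have [_ _ H1 H2 _] := zP n; split; [exact: le_trans H1 | exact: le_trans ih2].
have x0ab : a <= x0 <= b.
  have := x0P 0%N; have := za 0%N; rewrite /=; lra.
have y0cd : c <= y0 <= d.
  have := y0P 0%N; have := zc 0%N; rewrite /=; lra.
have [p [q [q' H]]] := PQ _ _ x0ab y0cd.
apply/eqP; rewrite -normr_le0; apply/ler_addgt0Pr => e e0; rewrite add0r.
pose S := (b - a) + (d - c).
have S0 : 0 <= S by rewrite addr_ge0 ?subr_ge0.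
(* The half-perimeter after n steps is S / 2 ^ n, so the final bound is e S^2 / (S^2 + 1); adding 1
   covers the case S = 0. *)
have e'0 : 0 < e / (2 * (S ^+ 2 + 1)).
  by rewrite divr_gt0// mulr_gt0// ltr_wpDl// sqr_ge0.
have [r r0 [aP aQ]] := H _ e'0.
have [n nP] : exists n, S / 2 ^+ n < r.
  exists (Num.truncn (S / r)).+1; rewrite ltr_pdivrMr ?exprn_gt0//.
  rewrite mulrC -ltr_pdivrMr//; apply: (lt_trans (truncnS_gt _)).
  by rewrite -natrX ltr_nat ltn_expl.
have wr : w n < r.
  by apply: le_lt_trans nP; rewrite /w /S ler_pM2r ?invr_gt0 ?exprn_gt0// lerDl subr_ge0.
have hr : h n < r.
  by apply: le_lt_trans nP; rewrite /h /S ler_pM2r ?invr_gt0 ?exprn_gt0// lerDr subr_ge0.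
apply: (le_trans (Jn n)).
have [za1 za2] := za n; have [zc1 zc2] := zc n.
have := @circulation_approx x0 y0 p q q' _ r (z n).1 ((z n).1 + w n) (z n).2 ((z n).2 + h n) (ltW e'0).
rewrite (addrC _ (w n)) addrK (addrC _ (h n)) addrK => K.
have {}K : `|J n (z n)| <= 2 * (e / (2 * (S ^+ 2 + 1))) * (w n + h n) ^+ 2.
  rewrite /J (addrC _ (w n)) (addrC _ (h n)); apply: K => //.
  - by move=> x y xx yy; apply: dPhi; lra.
  - by move=> x y xx yy; apply: dPsi; lra.
  - by rewrite (addrC (w n)).
  - by rewrite (addrC (h n)).
apply: le_trans (ler_wpM2l _ K) _; first by rewrite exprn_ge0.
have -> : 4 ^+ n * (2 * (e / (2 * (S ^+ 2 + 1))) * (w n + h n) ^+ 2) = e * (S ^+ 2 / (S ^+ 2 + 1)).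
  have -> : (4 : R) ^+ n = (2 ^+ n) ^+ 2 by rewrite -exprM mulnC exprM -[in RHS]natrX.
  rewrite /w /h -mulrDl -/S; field.
  rewrite expf_neq0//= gt_eqF// ltr_wpDl// sqr_ge0//.
by rewrite ler_piMr// ?ltW// ltr_pdivrMr ?mul1r ?ltrDl// ltr_wpDl// sqr_ge0.
Qed.

End goursat.

(** * The complex modulus and the complex exponential *)

Section normc.
Context {R : realType}.
Implicit Types (z w k : R[i]) (e d : R).

Lemma normrcE z : `|z| = (normc z)%:C. Proof. by []. Qed.

Lemma normc_ge0 z : 0 <= normc z.
Proof. by case: z => x y; rewrite sqrtr_ge0. Qed.

Lemma sqr_normcE z : normc z ^+ 2 = complex.Re z ^+ 2 + complex.Im z ^+ 2.
Proof. by case: z => x y /=; rewrite sqr_sqrtr ?addr_ge0 ?sqr_ge0. Qed.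

Lemma normRe_le z : `|complex.Re z| <= normc z.
Proof.
by rewrite -ler_sqr ?nnegrE ?normc_ge0// sqr_normcE real_normK ?num_real// lerDl sqr_ge0.
Qed.

Lemma normIm_le z : `|complex.Im z| <= normc z.
Proof.
by rewrite -ler_sqr ?nnegrE ?normc_ge0// sqr_normcE real_normK ?num_real// lerDr sqr_ge0.
Qed.

Lemma normc_le_ReIm z : normc z <= `|complex.Re z| + `|complex.Im z|.
Proof.
rewrite -ler_sqr ?nnegrE ?normc_ge0 ?addr_ge0// sqr_normcE sqrrD !real_normK ?num_real//.
by rewrite addrAC lerDl mulrn_wge0// mulr_ge0.
Qed.

Lemma normc_lt z e : (`|z| < e%:C) = (normc z < e).
Proof. by rewrite normrcE ltcR. Qed.

Lemma normc_le z e : (`|z| <= e%:C) = (normc z <= e).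
Proof. by rewrite normrcE lecR. Qed.

Lemma normc_lt1 z : (`|z| < 1) = (normc z < 1).
Proof. exact: (normc_lt z 1). Qed.

Lemma gt0_complexE (z : R[i]) : 0 < z -> z = (complex.Re z)%:C /\ 0 < complex.Re z.
Proof. by case: z => x y; rewrite ltcE/= => /andP[/eqP -> x0]. Qed.

Lemma normc_gt0 z : (0 < normc z) = (z != 0).
Proof. by rewrite -[LHS]ltcR -normrcE normr_gt0. Qed.

Lemma derivable_approx (f : R[i] -> R[i]) a e : derivable f a 1 -> 0 < e ->
  exists2 d, 0 < d & forall k, normc k < d ->
    normc (f (a + k) - f a - 'D_1 f a * k) <= e * normc k.
Proof.
move=> df e0; have e0C : (0 : R[i]) < e%:C by rewrite ltcR.
have df' : (fun h => h^-1 *: ((f \o shift a) (h *: 1) - f a)) @ 0^' --> 'D_1 f a by exact: df.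
have := (cvgrPdist_le _ _).1 df' _ e0C => - [d' /= d'0 H].
have [dE d0] := gt0_complexE d'0.
exists (complex.Re d') => // k kd.
have [->|k0] := eqVneq k 0; first by rewrite addr0 subrr mulr0 subr0 normc0 mulr0.
have := H k; rewrite /ball/= sub0r normrN dE normc_lt => /(_ kd k0).
rewrite normc_le => K.
have -> : f (a + k) - f a - 'D_1 f a * k = - (('D_1 f a - k^-1 *: (f (k *: 1 + a) - f a)) * k).
  by rewrite /GRing.scale/= mulr1 (addrC k) mulrBl mulrAC mulVf// mul1r; ring.
by rewrite normcN normcM ler_wpM2r ?normc_ge0.
Qed.

Lemma approx_derivable (f : R[i] -> R[i]) a (D : R[i]) :
  (forall e, 0 < e -> exists2 d, 0 < d & forall k, normc k < d ->
    normc (f (a + k) - f a - D * k) <= e * normc k) ->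
  is_derive a 1 f D.
Proof.
move=> H.
suff cf : (fun h => h^-1 *: ((f \o shift a) (h *: 1) - f a)) @ 0^' --> D.
  by split; [apply/cvg_ex; exists D | exact: cvg_lim].
apply/cvgrPdist_le => e' e'0; have [eE e0] := gt0_complexE e'0.
have [d d0 Hd] := H _ e0.
exists d%:C => /=; first by rewrite ltcR.
move=> k /=; rewrite /ball/= sub0r normrN normc_lt => kd k0.
rewrite eE normc_le.
have -> : D - k^-1 *: (f (k *: 1 + a) - f a) = - ((f (a + k) - f a - D * k) / k).
  by rewrite /GRing.scale/= mulr1 (addrC k) mulrBl mulfK//; ring.
rewrite normcN normcM normcV ler_pdivrMr ?normc_gt0//; exact: Hd.
Qed.

Definition expC (w : R[i]) : R[i] :=
  (expR (complex.Re w) * cos (complex.Im w)) +i* (expR (complex.Re w) * sin (complex.Im w)).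

Lemma expCD w k : expC (w + k) = expC w * expC k.
Proof.
case: w => x y; case: k => x' y'; rewrite /expC/=; simpc.
by congr (_ +i* _); rewrite expRD ?cosD ?sinD; ring.
Qed.

Lemma normc_expC w : normc (expC w) = expR (complex.Re w).
Proof.
case: w => x y; rewrite /expC/= !exprMn -mulrDr cos2Dsin2 mulr1 sqrtr_sqr.
by rewrite ger0_norm// expR_ge0.
Qed.

Lemma expC_neq0 w : expC w != 0.
Proof. by rewrite -normc_gt0 normc_expC expR_gt0. Qed.

Lemma is_derive1_approx (f : R -> R) (D e : R) : is_derive (0 : R) 1 f D -> 0 < e ->
  exists2 d, 0 < d & forall x, `|x| < d -> `|f x - f 0 - D * x| <= e * `|x|.
Proof.
move=> [df <-] e0.
have df' : (fun h => h^-1 *: ((f \o shift (0 : R)) (h *: (1 : R)) - f 0)) @ 0^' --> 'D_1 f 0 by exact: df.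
have := (cvgrPdist_le _ _).1 df' _ e0 => - [d /= d0 H]; exists d => // x xd.
have [->|x0] := eqVneq x 0; first by rewrite subrr mulr0 subr0 normr0 mulr0.
have := H x; rewrite /ball/= sub0r normrN => /(_ xd x0) K.
have -> : f x - f 0 - 'D_1 f 0 * x = - (('D_1 f 0 - x^-1 *: (f (x *: 1 + 0) - f 0)) * x).
  by rewrite /GRing.scale/= mulr1 addr0 mulrBl mulrAC mulVf// mul1r; ring.
by rewrite normrN normrM ler_wpM2r.
Qed.

Lemma derivable_expC w : derivable expC w 1.
Proof.
suff : is_derive w 1 expC (expC w) by case.
apply: approx_derivable => e e0.
have wgt0 : 0 < normc (expC w) by rewrite normc_gt0 expC_neq0.
(* The real and imaginary parts of exp k - 1 - k together cost fewer than 12 multiples of e1 |k|;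
   [e1 <= 1] keeps |k| below 1, whence the bound 3 on the real exponential. *)
have [e1 [e10 e11 e12]] : exists e1, [/\ 0 < e1, e1 <= 1 & e1 <= e / normc (expC w) / 12].
  exists (Num.min 1 (e / normc (expC w) / 12)).
  by rewrite lt_min ltr01/= !divr_gt0// !ge_min !lexx orbT.
have [d1 d10 H1] := is_derive1_approx (@is_derive_expR R 0) e10.
have [d2 d20 H2] := is_derive1_approx (@is_derive_cos R 0) e10.
have [d3 d30 H3] := is_derive1_approx (@is_derive_sin R 0) e10.
exists (Num.min (Num.min d1 d2) (Num.min d3 e1)).
  by rewrite !lt_min d10 d20 d30 e10.
move=> k; rewrite !lt_min => /andP[/andP[kd1 kd2] /andP[kd3 k1]].
(* The functional equation reduces the estimate to the origin. *)
have -> : expC (w + k) - expC w - expC w * k = expC w * (expC k - 1 - k).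
  by rewrite expCD; ring.
rewrite normcM.
suff : normc (expC k - 1 - k) <= 12 * e1 * normc k.
  move=> H; apply: (le_trans (ler_wpM2l (ltW wgt0) H)).
  rewrite !mulrA ler_wpM2r ?normc_ge0//.
  have H' := ler_wpM2l (ltW wgt0) e12.
  have -> : e = 12 * (normc (expC w) * (e / normc (expC w) / 12)).
    by field; rewrite gt_eqF.
  lra.
have xN := normRe_le k; have yN := normIm_le k; have N0 := normc_ge0 k.
apply: (le_trans (normc_le_ReIm _)).
have -> : complex.Re (expC k - 1 - k) = expR (complex.Re k) * cos (complex.Im k) - 1 - complex.Re k.
  by case: k {kd1 kd2 kd3 k1 xN yN N0}.
have -> : complex.Im (expC k - 1 - k) = expR (complex.Re k) * sin (complex.Im k) - complex.Im k.
  by case: k {kd1 kd2 kd3 k1 xN yN N0} => x y; rewrite /expC/= oppr0 addr0.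
move: (normc k) (complex.Re k) (complex.Im k) => N x y in kd1 kd2 kd3 k1 xN yN N0 *.
have := H1 x (le_lt_trans xN kd1); have := H2 y (le_lt_trans yN kd2); have := H3 y (le_lt_trans yN kd3).
rewrite expR0 cos0 sin0 oppr0 mul0r !subr0 !addr0 !mul1r => K3 K2 K1.
have L1 : `|expR x - 1 - x| <= e1 * N by rewrite (le_trans K1)// ler_wpM2l// ltW.
have L2 : `|cos y - 1| <= e1 * N by rewrite (le_trans K2)// ler_wpM2l// ltW.
have L3 : `|sin y - y| <= e1 * N by rewrite (le_trans K3)// ler_wpM2l// ltW.
have NN : e1 * N <= N by rewrite ler_piMl.
have N1 : N <= 1 by rewrite (le_trans _ e11)// ltW.
have E3 : `|expR x| <= 3.
  have -> : expR x = (expR x - 1 - x) + 1 + x by ring.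
  rewrite (le_trans (ler_normD _ _))//; apply: (le_trans (lerD (ler_normD _ _) (lexx _))).
  rewrite normr1; lra.
have Ex : `|expR x - 1| <= 2 * N.
  have -> : expR x - 1 = (expR x - 1 - x) + x by ring.
  rewrite (le_trans (ler_normD _ _))//; lra.
have -> : expR x * cos y - 1 - x = (expR x - 1 - x) + expR x * (cos y - 1) by ring.
have -> : expR x * sin y - y = expR x * (sin y - y) + (expR x - 1) * y by ring.
have := ler_normD (expR x - 1 - x) (expR x * (cos y - 1)).
have := ler_normD (expR x * (sin y - y)) ((expR x - 1) * y).
rewrite !normrM.
have := ler_pM (normr_ge0 _) (normr_ge0 _) E3 L2.
have := ler_pM (normr_ge0 _) (normr_ge0 _) E3 L3.
have := ler_pM (normr_ge0 _) (normr_ge0 _) Ex yN.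
have : 2 * N * N <= 2 * e1 * N by rewrite ler_wpM2r// ler_wpM2l// ltW.
have : 0 <= e1 * N by rewrite mulr_ge0// ltW.
lra.
Qed.

End normc.

(** * The Schwarz lemma *)

Section schwarz.
Context {R : realType}.
Implicit Types (g H f : R[i] -> R[i]).

(* By the Cauchy-Riemann equations, Im H dx + Re H dy = Im (H (dx + i dy)) is a closed form. *)
Lemma derivable_closed_at H (x y : R) : derivable H (x +i* y) 1 ->
  closed_at (fun x y => complex.Im (H (x +i* y))) (fun x y => complex.Re (H (x +i* y))) x y.
Proof.
move=> dH; set z := x +i* y in dH; pose D := 'D_1 H z.
exists (complex.Im D), (complex.Re D), (- complex.Im D) => e e0.
have [d d0 Hd] := derivable_approx dH e0.
exists (d / 2); first by rewrite divr_gt0.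
have K x' y' : `|x' - x| < d / 2 -> `|y' - y| < d / 2 ->
    normc (H (x' +i* y') - H z - D * ((x' - x) +i* (y' - y))) <= e * (`|x' - x| + `|y' - y|).
  move=> xd yd; have := normc_le_ReIm ((x' - x) +i* (y' - y)) => /= kxy.
  have -> : x' +i* y' = z + ((x' - x) +i* (y' - y)).
    by rewrite /z; simpc; rewrite !(addrC x) !(addrC y) !subrK.
  apply: (le_trans (Hd _ _)); last by rewrite ler_wpM2l// ltW.
  apply: (le_lt_trans kxy); lra.
split=> x' y' xd yd; apply: le_trans (K _ _ xd yd).
- apply: le_trans (normIm_le _); rewrite -/z.
  rewrite /D; move: (H (x' +i* y')) (H z) ('D_1 H z) => [a b] [a' b'] [p q].
  by simpc => /=; rewrite le_eqVlt; apply/orP; left; apply/eqP; congr (`|_|); ring.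
- apply: le_trans (normRe_le _); rewrite -/z.
  rewrite /D; move: (H (x' +i* y')) (H z) ('D_1 H z) => [a b] [a' b'] [p q].
  by simpc => /=; rewrite le_eqVlt; apply/orP; left; apply/eqP; congr (`|_|); ring.
Qed.

Lemma affine_approx_continuous (U : R -> R -> R) x0 y0 p q r : 0 < r ->
  affine_approx U x0 y0 p q 1 r ->
  {for x0, continuous (U ^~ y0)} /\ {for y0, continuous (U x0)}.
Proof.
move=> r0 aU; split; apply/cvgrPdist_lt => e e0.
- pose K := 1 + `|p|.
  have K0 : 0 < K by rewrite ltr_pwDl.
  near=> x; have xr : `|x - x0| < r.
    rewrite distrC; near: x; exact: (@cvgr_dist_lt _ R^o _ _ _ (fun y => y) x0 cvg_id).
  have xe : `|x - x0| < e / K.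
    rewrite distrC; near: x; apply: (@cvgr_dist_lt _ R^o _ _ _ (fun y => y) x0 cvg_id).
    by rewrite divr_gt0.
  have := aU x y0 xr; rewrite subrr normr0 mulr0 !addr0 mul1r => /(_ r0) H.
  rewrite distrC (_ : _ - _ = (U x y0 - (U x0 y0 + p * (x - x0))) + p * (x - x0)); last by ring.
  apply: (le_lt_trans (ler_normD _ _)); rewrite normrM.
  by apply: (le_lt_trans (lerD H (lexx _))); rewrite -[X in X + _]mul1r -mulrDl mulrC -ltr_pdivlMr.
- pose K := 1 + `|q|.
  have K0 : 0 < K by rewrite ltr_pwDl.
  near=> y; have yr : `|y - y0| < r.
    rewrite distrC; near: y; exact: (@cvgr_dist_lt _ R^o _ _ _ (fun y => y) y0 cvg_id).
  have ye : `|y - y0| < e / K.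
    rewrite distrC; near: y; apply: (@cvgr_dist_lt _ R^o _ _ _ (fun y => y) y0 cvg_id).
    by rewrite divr_gt0.
  have := aU x0 y; rewrite subrr normr0 mulr0 add0r addr0 mul1r => /(_ r0 yr) H.
  rewrite distrC (_ : _ - _ = (U x0 y - (U x0 y0 + q * (y - y0))) + q * (y - y0)); last by ring.
  apply: (le_lt_trans (ler_normD _ _)); rewrite normrM.
  by apply: (le_lt_trans (lerD H (lexx _))); rewrite -[X in X + _]mul1r -mulrDl mulrC -ltr_pdivlMr.
Unshelve. all: by end_near. Qed.

Lemma differentiable_comp_derivable f g z : derivable f z 1 -> derivable g (f z) 1 ->
  derivable (g \o f) z 1.
Proof.
move=> /derivable1_diffP df /derivable1_diffP dg; apply/derivable1_diffP.
exact: differentiable_comp.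
Qed.

Lemma expC_periodic (x : R) : expC (x +i* (pi *+ 2)) = expC (x +i* 0).
Proof. by rewrite /expC/= cos2pi sin2pi cos0 sin0. Qed.

(* The mean of Re (g u / u) over the circle |u| = e^x does not depend on x. *)
Lemma schwarz_real g (m : R) : (forall u, normc u < 1 -> derivable g u 1) ->
  (forall u, normc u < 1 -> normc (g u) <= 1) -> g 0 = 0 -> 'D_1 g 0 = m%:C -> m <= 1.
Proof.
move=> dg g1 g0 Dg; rewrite leNgt; apply/negP => m1.
(* This is g(u)/u in the coordinate u = exp w, on the half-plane Re w < 0. *)
pose H w := g (expC w) * (expC w)^-1.
have expC1 x y : x < 0 -> normc (expC (x +i* y)) < 1 :> R.
  by move=> x0; rewrite normc_expC/= expR_lt1.
have dH x y : x < 0 -> derivable H (x +i* y) 1.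
  move=> x0; have -> : H = (fun u => g u * u^-1) \o expC by [].
  apply: differentiable_comp_derivable; first exact: derivable_expC.
  apply: (@derivableM R[i] R[i] g (fun u => u^-1)); first by apply: dg; exact: expC1.
  by apply: derivableV => //; exact: expC_neq0.
have Hexp x y : x < 0 -> normc (H (x +i* y)) <= expR (- x).
  move=> x0; rewrite normcM normcV normc_expC/= expRN ler_piMl ?invr_ge0 ?expR_ge0//.
  by apply: g1; exact: expC1.
pose P x y := complex.Im (H (x +i* y)); pose Q x y := complex.Re (H (x +i* y)).
have PQ x y : x < 0 -> closed_at P Q x y by move=> x0; apply: derivable_closed_at; exact: dH.
have e0 : 0 < (m - 1) / 4 by rewrite divr_gt0// subr_gt0.
(* [H] tends to g'(0) = m as Re w tends to minus infinity. *)
have [d d0 Hd] : exists2 d, 0 < d & forall x y, x < 0 -> expR x < d -> `|Q x y - m| <= (m - 1) / 4.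
  have dg0 : derivable g 0 1 by apply: dg; rewrite normc0.
  have [d d0 Hd] := derivable_approx dg0 e0; exists d => // x y x0 xd.
  have E0 := expC_neq0 (x +i* y).
  have -> : Q x y - m = complex.Re (H (x +i* y) - m%:C) by rewrite /Q; case: (H _).
  apply: (le_trans (normRe_le _)).
  have := Hd (expC (x +i* y)); rewrite normc_expC/= g0 add0r subr0 Dg => /(_ xd) K.
  have -> : H (x +i* y) - m%:C = (g (expC (x +i* y)) - m%:C * expC (x +i* y)) / expC (x +i* y).
    by rewrite mulrBl mulfK.
  by rewrite normcM normcV normc_expC/= ler_pdivrMr ?expR_gt0.
(* On Re w = b the bound exp (- b) on |H| is exactly q, so the mean of Re H is at most (1 + m) / 2;
   on Re w = a it is at least m - (m - 1) / 4. As m > 1 the second exceeds the first. *)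
pose q := (1 + m) / 2.
have q1 : 1 < q by rewrite /q; lra.
pose b := - ln q.
have b0 : b < 0 by rewrite oppr_lt0 ln_gt0.
pose a := Num.min b (ln d) - 1.
have ab : a < b.
  have : Num.min b (ln d) <= b by rewrite ge_min lexx.
  by rewrite /a; lra.
have ad : expR a < d.
  rewrite -[ltRHS](lnK (x := d)) ?posrE// ltr_expR.
  have : Num.min b (ln d) <= ln d by rewrite ge_min lexx orbT.
  by rewrite /a; lra.
have pi2 : 0 < pi *+ 2 :> R by rewrite mulrn_wgt0// pi_gt0.
have cont x y : x < 0 -> {for x, continuous (P ^~ y)} /\ {for y, continuous (Q x)}.
  move=> x0; have [p [q' [q'' K]]] := PQ x y x0.
  have [r r0 [aP aQ]] := K _ ltr01.
  by have [] := affine_approx_continuous r0 aP; have [] := affine_approx_continuous r0 aQ.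
(* [continuous_primitive] differentiates only at interior points, hence intervals larger than the
   rectangle; b < b / 2 < 0 as b is negative. *)
have /choice[Phi dPhi] : forall y, exists G : R -> R, forall x, a - 1 < x < b / 2 -> is_derive x 1 G (P x y).
  move=> y; apply: continuous_primitive => x /andP[_ xb].
  by have [] := cont x y _; first by lra.
have /choice[Psi dPsi] : forall x, exists G : R -> R, x < 0 -> forall y, -1 < y < pi *+ 2 + 1 -> is_derive y 1 G (Q x y).
  move=> x; have [x0|x0] := ltP x 0; last by exists id.
  have [G GP] := @continuous_primitive _ (Q x) (-1) (pi *+ 2 + 1) (fun y _ => (cont x y x0).2).
  by exists G.
have dPhi' x y : a <= x <= b -> 0 <= y <= pi *+ 2 -> is_derive x 1 (Phi y) (P x y).
  by move=> xab _; apply: dPhi; lra.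
have dPsi' x y : a <= x <= b -> 0 <= y <= pi *+ 2 -> is_derive y 1 (Psi x) (Q x y).
  by move=> xab y2; apply: dPsi; lra.
have := circulation_eq0 (ltW ab) (ltW pi2) dPhi' dPsi'.
have PQab x y : a <= x <= b -> 0 <= y <= pi *+ 2 -> closed_at P Q x y.
  by move=> xab _; apply: PQ; lra.
move=> /(_ PQab); rewrite /circulation.
(* The two horizontal sides cancel by periodicity of the exponential. *)
have PhiE : Phi (pi *+ 2) b - Phi (pi *+ 2) a = Phi 0 b - Phi 0 a.
  suff : `|(Phi (pi *+ 2) \- Phi 0) b - (Phi (pi *+ 2) \- Phi 0) a| <= 0 * (b - a).
    by rewrite mul0r normr_le0 /= => /eqP; lra.
  apply: (@increment_le_derive_bound _ _ (fun x => P x (pi *+ 2) - P x 0)); first exact: ltW.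
    by move=> x xab; apply: is_deriveB; apply: dPhi' => //; lra.
  by move=> x xab; rewrite /P /H expC_periodic subrr normr0.
have Aa : `|Psi a (pi *+ 2) - Psi a 0 - m * (pi *+ 2)| <= (m - 1) / 4 * (pi *+ 2).
  have := @increment_le_derive_bound _ (Psi a \- (fun y => m * y)) (fun y => Q a y - m) 0 (pi *+ 2) ((m - 1) / 4) (ltW pi2).
  rewrite subr0 /= mulr0 subr0 addrAC; apply => y y2; last by apply: Hd => //; lra.
  apply: is_deriveB; first by apply: dPsi' => //; lra.
  by apply: is_derive_eq; rewrite /GRing.scale/= mulr1.
have Ab : `|Psi b (pi *+ 2) - Psi b 0| <= q * (pi *+ 2).
  have := @increment_le_derive_bound _ (Psi b) (Q b) 0 (pi *+ 2) q (ltW pi2).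
  rewrite subr0; apply => y y2; first by apply: dPsi' => //; lra.
  apply: (le_trans (normRe_le _)); apply: (le_trans (Hexp _ _ b0)).
  by rewrite /b opprK lnK// posrE; lra.
move: Aa Ab; rewrite !ler_norml => /andP[A1 _] /andP[_ A2] J0.
have : (m - (m - 1) / 4) * (pi *+ 2) <= q * (pi *+ 2) by rewrite mulrBl; lra.
by rewrite ler_pM2r// /q; lra.
Qed.

(** A unimodular factor [c] turns g'(0) into its modulus, which is the real case. *)
Lemma schwarz g : (forall u, normc u < 1 -> derivable g u 1) ->
  (forall u, normc u < 1 -> normc (g u) <= 1) -> g 0 = 0 -> normc ('D_1 g 0) <= 1.
Proof.
move=> dg g1 g0; set D := 'D_1 g 0.
have [->|D0] := eqVneq D 0; first by rewrite normc0.
have nD0 : 0 < normc D by rewrite normc_gt0.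
pose c := (normc D)%:C / D.
have c1 : normc c = 1.
  by rewrite normcM normcV /= expr0n addr0 sqrtr_sqr ger0_norm ?normc_ge0// divff// gt_eqF.
have dg0 : derivable g 0 1 by apply: dg; rewrite normc0.
apply: (@schwarz_real (c \*: g)).
- by move=> u u1; apply: derivableZ; exact: dg.
- by move=> u u1; rewrite /GRing.scale/= normcM c1 mul1r; exact: g1.
- by rewrite /= g0 scaler0.
- by rewrite deriveZ//= -/D /GRing.scale/= /c mulrVK// unitfE.
Qed.

End schwarz.

Lemma mx_cvg_entries (U : topologicalType) (T : Type) (F : set_system T) (FF : Filter F) m n
    (f : T -> 'M[U]_(m, n)) (M : 'M[U]_(m, n)) :
  (forall i j, (fun x => f x i j) @ F --> M i j) -> f @ F --> M.
Proof.
move=> fM A [P MP PA]; rewrite /nbhs/=.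
have : \forall x \near F, forall ij, P ij.1 ij.2 (f x ij.1 ij.2).
  by apply: filter_forall => -[i j] /=; exact: (fM i j _ (MP i j)).
by apply: filterS => x Px; apply: PA => i j; exact: (Px (i, j)).
Qed.

Section row_derivatives.
Context {R : realType} {n : nat}.
Implicit Types (f : R[i] -> 'rV[R[i]]_n) (u : R[i]).

Lemma is_derive_coord f u (p : 'I_n) : derivable f u 1 ->
  is_derive u 1 (fun x => f x 0 p) (('D_1 f u) 0 p).
Proof.
move=> df.
have H : (fun h => h^-1 *: (((fun x => f x 0 p) \o shift u) (h *: 1) - f u 0 p)) @ 0^' --> ('D_1 f u) 0 p.
  rewrite (_ : (fun h => _) = (fun M : 'rV_n => M 0 p) \o (fun h => h^-1 *: ((f \o shift u) (h *: 1) - f u))).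
    by apply: cvg_comp; [exact: df|exact: coord_continuous].
  by apply/funext => h /=; rewrite !mxE.
by split; [apply/cvg_ex; exists (('D_1 f u) 0 p)|exact: cvg_lim].
Qed.

Lemma is_derive_row f u (D : 'rV[R[i]]_n) :
  (forall p, is_derive u 1 (fun x => f x 0 p) (D 0 p)) -> is_derive u 1 f D.
Proof.
move=> df.
have H : (fun h => h^-1 *: ((f \o shift u) (h *: 1) - f u)) @ 0^' --> D.
  apply: mx_cvg_entries => i p; rewrite ord1 => {i}.
  rewrite (_ : (fun h => _) = (fun h => h^-1 *: (((fun x => f x 0 p) \o shift u) (h *: 1) - f u 0 p))).
    by case: (df p) => + <-; exact.
  by apply/funext => h /=; rewrite !mxE.
split; first by apply/cvg_ex; exists D.
by apply: cvg_lim => //.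
Qed.

End row_derivatives.

Section schwarz_pick.
Context {R : realType}.

Lemma normc_conj (z : R[i]) : normc z^*%C = normc z.
Proof. by case: z => x y /=; rewrite sqrrN. Qed.

(** Source of the invariance of the unit disc under its automorphisms; it serves both [schwarz_pick]
    and [moebius_disc]. *)
Lemma moebius_sqr (w z : R[i]) :
  normc (1 - w^*%C * z) ^+ 2 - normc (z - w) ^+ 2 = (1 - normc w ^+ 2) * (1 - normc z ^+ 2).
Proof. by case: w => a b; case: z => c d; rewrite !sqr_normcE; simpc => /=; ring. Qed.

(** The Schwarz lemma for [G], the composite of [g] with the disc automorphism that sends [g 0] to
    0. *)
Lemma schwarz_pick (g : R[i] -> R[i]) : (forall u, normc u < 1 -> derivable g u 1) ->
  (forall u, normc u < 1 -> normc (g u) < 1) -> normc ('D_1 g 0) <= 1 - normc (g 0) ^+ 2.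
Proof.
move=> dg g1; pose w := g 0.
have n0 : normc (0 : R[i]) < 1 by rewrite normc0.
have w1 : normc w < 1 by exact: g1.
have den u : normc u < 1 -> 1 - w^*%C * g u != 0.
  move=> /g1 u1; rewrite subr_eq0; apply/eqP => /(congr1 (@normc R)).
  rewrite normc1 normcM normc_conj => E.
  have := normc_ge0 w; have := normc_ge0 (g u).
  have : normc w * normc (g u) < 1; last by lra.
  by rewrite mulr_ilt1 ?normc_ge0.
pose num (u : R[i]) := g u - w; pose dn (u : R[i]) := 1 - w^*%C * g u.
have dnum u : normc u < 1 -> derivable num u 1.
  by move=> u1; apply: derivableB; [exact: dg|exact: derivable_cst].
have ddn u : normc u < 1 -> derivable dn u 1.
  move=> u1; apply: derivableB; first exact: derivable_cst.
  by apply: (@derivableZ _ _ _ g (w^*%C)); exact: dg.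
pose G := num * (fun u => (dn u)^-1).
have dG u : normc u < 1 -> derivable G u 1.
  move=> u1; apply: derivableM; first exact: dnum.
  by apply: derivableV; [exact: den|exact: ddn].
have G0 : G 0 = 0 by rewrite /G /GRing.mul/= /num subrr mul0r.
have G1 u : normc u < 1 -> normc (G u) <= 1.
  move=> u1; have -> : G u = num u * (dn u)^-1 by [].
  rewrite normcM normcV ler_pdivrMr ?mul1r ?normc_gt0 ?den//.
  rewrite -ler_sqr ?nnegrE ?normc_ge0// -subr_ge0 moebius_sqr.
  by rewrite mulr_ge0// subr_ge0 expr_le1 ?normc_ge0// ltW// g1.
have := schwarz dG G1 G0.
have -> : 'D_1 G 0 = 'D_1 g 0 / (1 - normc w ^+ 2)%:C.
  rewrite /G deriveM; [|exact: dnum|by apply: derivableV; [exact: den|exact: ddn]].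
  have -> : num 0 = 0 by rewrite /num subrr.
  rewrite scale0r add0r /num deriveB; [|exact: dg|exact: derivable_cst].
  rewrite derive_cst subr0 /GRing.scale/= mulrC; congr (_ * _^-1).
  rewrite /dn -/w; case: (w) => a b; rewrite sqr_normcE; simpc => /=.
  by congr (_ +i* _); ring.
have w2 : 0 < 1 - normc w ^+ 2 by rewrite subr_gt0 expr_lt1 ?normc_ge0.
rewrite normcM normcV [normc _%:C]/= expr0n addr0 sqrtr_sqr gtr0_norm//.
by rewrite ler_pdivrMr// mul1r.
Qed.

Lemma kobayashi_metric_ge n (Om : set 'rV[R[i]]_n) (p : 'I_n) (z v : 'rV[R[i]]_n) :
  (forall w, Om w -> normc (w 0 p) < 1) ->
  ((normc (v 0 p) / (1 - normc (z 0 p) ^+ 2))%:E <= kobayashi_metric Om z v)%E.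
Proof.
move=> Om1; apply: le_ereal_inf_tmp => _ /= [l [f [df fOm f0 lv]] <-].
rewrite lee_fin.
have z1 : normc (z 0 p) < 1.
  by rewrite -f0; apply/Om1/fOm; rewrite normr0.
have df' u : normc u < 1 -> derivable f u 1 by move=> u1; apply: df; rewrite normc_lt1.
have n0 : normc (0 : R[i]) < 1 by rewrite normc0.
have := @schwarz_pick (fun u => f u 0 p).
have [_ ->] := is_derive_coord p (df' _ n0).
rewrite f0 => H.
rewrite -lv mxE normcM derive1E ler_pdivrMr ?subr_gt0 ?expr_lt1 ?normc_ge0//.
apply: ler_wpM2l; first exact: normc_ge0.
apply: H => u u1; first by have [] := is_derive_coord p (df' _ u1).
by apply/Om1/fOm; rewrite normc_lt1.
Qed.

End schwarz_pick.

(** * Lower bound for the Kobayashi distance *)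

Section mx_norm.
Context {R : realType} {n : nat}.

Lemma normr_coord_le (x : 'rV[R[i]]_n) p : `|x 0 p| <= `|x|.
Proof.
rewrite [leRHS]/Num.Def.normr/= mx_normE.
have -> : `|x 0 p| = (`|x 0 p|%:nng)%:num by [].
by rewrite num_le; exact: (le_bigmax _ (fun ij : 'I_1 * 'I_n => `|x ij.1 ij.2|%:nng) (0, p)).
Qed.

Lemma normr_row_le (x : 'rV[R[i]]_n) (e : R[i]) : 0 <= e ->
  (forall p, `|x 0 p| <= e) -> `|x| <= e.
Proof.
move=> e0 xe; rewrite [leLHS]/Num.Def.normr/= mx_normE.
have -> : e = (NngNum e0)%:num by [].
by rewrite num_le; apply/bigmax_leP; split => // -[i p] _ /=; rewrite ord1; exact: xe.
Qed.

End mx_norm.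

Section artanh.
Context {R : realType}.
Implicit Types t : R.

Definition artanh t : R := ln ((1 + t) / (1 - t)) / 2.

Lemma is_derive_artanh t : -1 < t < 1 -> is_derive t 1 artanh (1 - t ^+ 2)^-1.
Proof.
move=> /andP[t1 t2].
have H1 : 0 < 1 + t by lra.
have H2 : 0 < 1 - t by lra.
have H3 : 1 - t ^+ 2 != 0.
  by rewrite (_ : 1 - t ^+ 2 = (1 + t) * (1 - t)) ?mulf_neq0 ?gt_eqF//; ring.
have d1 : is_derive t 1 (fun x : R => 1 - x) (-1).
  by apply: is_derive_eq; ring.
have d2 : is_derive t 1 (fun x : R => 1 + x) 1.
  by apply: is_derive_eq; ring.
have d3 := @is_deriveV _ (fun x : R => 1 - x) t _ 1 (lt0r_neq0 H2) d1.
have d4 := is_deriveM d2 d3.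
have d5 : is_derive ((1 + t) / (1 - t)) 1 (@ln R) ((1 + t) / (1 - t))^-1.
  by apply: is_derive1_ln; rewrite divr_gt0.
have d6 := @is_derive1_comp _ (@ln R) ((fun x => 1 + x) * (fun x => (1 - x)^-1)) t _ _ d5 d4.
have := is_deriveZ 2^-1 d6.
rewrite (_ : 2^-1 \*: _ = artanh); last first.
  by apply/funext => x; rewrite /artanh [RHS]mulrC.
move=> H; apply: is_derive_eq; rewrite /GRing.scale/=; field.
by rewrite H3 !gt_eqF.
Qed.

(** The hyperbolic tangent. It recovers the derivative of a function X with values in (-1, 1) from
    that of artanh X. *)
Definition tanh2 t : R := (expR (2 * t) - 1) / (expR (2 * t) + 1).

Lemma artanhK t : -1 < t < 1 -> tanh2 (artanh t) = t.
Proof.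
move=> /andP[t1 t2]; rewrite /tanh2 /artanh [2 * _]mulrC divfK//.
rewrite lnK ?posrE; last by rewrite divr_gt0//; lra.
by field; rewrite !gt_eqF//=; lra.
Qed.

Lemma is_derive_tanh2 (s : R) : is_derive s 1 tanh2 (1 - tanh2 s ^+ 2).
Proof.
have H : expR (2 * s) + 1 != 0 by rewrite gt_eqF// addr_gt0// expR_gt0.
have d0 : is_derive s 1 (fun x : R => 2 * x) 2.
  by apply: is_derive_eq; rewrite /GRing.scale/= mulr1.
have d := is_derive1_comp (is_derive_expR (2 * s)) d0.
have d1 : is_derive s 1 (fun x : R => expR (2 * x) - 1) (expR (2 * s) * 2 - 0).
  exact: is_deriveB.
have d2 : is_derive s 1 (fun x : R => expR (2 * x) + 1) (expR (2 * s) * 2 + 0).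
  exact: is_deriveD.
have d3 := is_deriveM d1 (@is_deriveV _ (fun x : R => expR (2 * x) + 1) s _ 1 H d2).
apply: is_derive_eq; rewrite /GRing.scale/= /tanh2; field.
exact: H.
Qed.

Lemma artanh_lipschitz (r t u : R) : 0 <= r < 1 -> `|t| <= r -> `|u| <= r ->
  `|artanh t - artanh u| <= (1 - r ^+ 2)^-1 * `|t - u|.
Proof.
move=> /andP[r0 r1]; wlog ut : t u / u <= t.
  move=> wl tr ur; have [ut|/ltW tu] := leP u t; first exact: wl.
  by rewrite distrC (distrC t); apply: wl.
move=> tr ur; rewrite [`|t - u|]ger0_norm ?subr_ge0//.
apply: (@increment_le_derive_bound _ _ (fun x => (1 - x ^+ 2)^-1)) => // x /andP[ux xt].
  by apply: is_derive_artanh; move: tr ur; rewrite !ler_norml; lra.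
have xr : `|x| <= r by move: tr ur; rewrite !ler_norml; lra.
have r2 : 0 < 1 - r ^+ 2 by rewrite subr_gt0 expr_lt1.
have xr2 : x ^+ 2 <= r ^+ 2 by rewrite -real_normK ?num_real// ler_sqr ?nnegrE.
rewrite ger0_norm ?invr_ge0; last by lra.
by rewrite lef_pV2 ?posrE//; lra.
Qed.

End artanh.

Section clamp.
Context {R : realType}.
Variables (a b : R).
Hypothesis ab : a <= b.

(** Extends a curve on [a, b] by constants to the whole line, where [ac] lives. *)
Definition clamp (t : R) := Num.max a (Num.min t b).

Lemma clamp_itv t : a <= clamp t <= b.
Proof. by rewrite /clamp le_max lexx/= ge_max ab ge_min lexx orbT. Qed.

Lemma clamp_id t : a <= t <= b -> clamp t = t.
Proof. by move=> /andP[? ?]; rewrite /clamp (min_idPl _)// (max_idPr _). Qed.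

Lemma clamp_homo : {homo clamp : x y / x <= y}.
Proof.
move=> x y xy; rewrite /clamp ge_max !le_max lexx/=; apply/orP; right.
by rewrite le_min !ge_min xy lexx orbT.
Qed.

Lemma clamp_nonexpansive x y : x <= y -> clamp y - clamp x <= y - x.
Proof.
move=> xy; rewrite /clamp; set u := Num.min x b; set v := Num.min y b.
have vu : 0 <= v - u <= y - x.
  by rewrite /u /v /Num.min; case: (ltP x b) => ?; case: (ltP y b) => ?; lra.
by rewrite /Num.max; case: (ltP a u) => ?; case: (ltP a v) => ?; lra.
Qed.

End clamp.

Section kobayashi_lower_bound.
Context {R : realType} {n : nat}.

Lemma abs_continuous_ac (a b : R) (g : R -> 'rV[R[i]]_n) (p : 'I_n) : a <= b ->
  abs_continuous a b g -> ac (fun t => complex.Re (g (clamp a b t) 0 p)).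
Proof.
move=> ab acg e e0; have e0C : (0 : R[i]) < e%:C by rewrite ltcR.
have [d d0 Hd] := acg _ e0C; exists d => // l ol dl ll.
pose c := clamp a b.
pose s (i : 'I_(size l)) := c (nth (0, 0) l i).1.
pose t (i : 'I_(size l)) := c (nth (0, 0) l i).2.
have memo i : (i < size l)%N -> ordered_pair (nth (0, 0) l i).
  by move=> il; apply: (allP ol); exact: mem_nth.
have := Hd (size l) s t.
have H1 i : [/\ a <= s i, s i <= t i & t i <= b].
  have /andP[? _] := clamp_itv ab (nth (0, 0) l i).1.
  have /andP[_ ?] := clamp_itv ab (nth (0, 0) l i).2.
  by split => //; apply: clamp_homo => //; exact: memo.
have disj (i j : 'I_(size l)) : (i < j)%N -> `]s i, t i[%classic `&` `]s j, t j[%classic = set0.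
  move=> ij; apply/seteqP; split => // x [] /=; rewrite !in_itv/= => /andP[six xti] /andP[sjx xtj].
  have /pairwiseP := dl => /(_ (0, 0) i j (ltn_ord i) (ltn_ord j) ij).
  move=> /orP[] /(clamp_homo a b) K.
    by have := lt_trans (le_lt_trans (K : t i <= s j) sjx) xti; rewrite ltxx.
  by have := lt_trans (le_lt_trans (K : t j <= s i) six) xtj; rewrite ltxx.
have H2 : trivIset [set: 'I_(size l)] (fun i => [set` `]s i, t i[]).
  apply/trivIsetP => i j _ _ /eqP ij.
  have [ltij|ltji|/val_inj//] := ltngtP i j; first exact: disj.
  by rewrite setIC; exact: disj.
have H3 : \sum_i (t i - s i) < d.
  apply: le_lt_trans ll; rewrite /total_length (big_nth (0, 0)) big_mkord.
  by apply: ler_sum => i _; apply: clamp_nonexpansive => //; exact: memo.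
move=> /(_ H1 H2 H3) H; rewrite -lecR; apply: le_trans (ltW H).
rewrite /total_increment (big_nth (0, 0)) big_mkord rmorph_sum/=.
apply: ler_sum => i _; apply: le_trans (normr_coord_le _ p).
have : `|complex.Re (g (t i) 0 p) - complex.Re (g (s i) 0 p)| <= normc ((g (t i) - g (s i)) 0 p).
  by apply: le_trans (normRe_le _); rewrite !mxE; case: (g (t i) 0 p); case: (g (s i) 0 p).
by rewrite -lecR; exact.
Qed.

(** The real part of one coordinate suffices: for X = Re z_p one has |z_p'| / (1 - |z_p|^2) >= |X'|
    / (1 - X^2) = |(artanh X)'|, and the increment of artanh X is at most the integral of the
    absolute value of its derivative. *)
Lemma kobayashi_edist_ge (Om : set 'rV[R[i]]_n) (p : 'I_n) (x y : 'rV[R[i]]_n) :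
  (forall w, Om w -> normc (w 0 p) < 1) ->
  ((artanh (complex.Re (y 0 p)) - artanh (complex.Re (x 0 p)))%:E <= kobayashi_edist Om x y)%E.
Proof.
move=> Om1; apply: le_ereal_inf_tmp => _ /= [a [b [g [ab acg gOm [ga gb] ->]]]].
pose X t := complex.Re (g (clamp a b t) 0 p).
have acX : ac X by exact: abs_continuous_ac.
have X1 t : `|X t| < 1.
  by apply: (le_lt_trans (normRe_le _)); apply/Om1/gOm/clamp_itv.
have cX : continuous X by exact: ac_continuous.
(* By compactness X stays away from 1 and -1, where artanh is not Lipschitz. *)
have [r r01 Xr] : exists2 r, 0 <= r < 1 & forall t, `|X t| <= r.
  have cN : {within `[a, b], continuous (fun t => `|X t|)}.
    apply: continuous_subspaceT => t; apply: (@continuous_comp _ _ _ X Num.norm); first exact: cX.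
    exact: norm_continuous.
  have [c _ cP] := EVT_max ab cN.
  exists `|X c|; first by rewrite normr_ge0 X1.
  move=> t; have -> : X t = X (clamp a b t) by rewrite /X (clamp_id (clamp_itv ab t)).
  by apply: cP; rewrite in_itv/= clamp_itv.
have /andP[r0 r1] := r01.
have r2 : 0 < 1 - r ^+ 2 by rewrite subr_gt0 expr_lt1.
have ach : ac (artanh \o X).
  move=> e e0; have e'0 : 0 < e * (1 - r ^+ 2) by rewrite mulr_gt0.
  have [d d0 hd] := acX _ e'0; exists d => // l ol dl ll.
  have := hd _ ol dl ll; rewrite -ler_pdivrMr//; apply: le_trans.
  rewrite /total_increment mulr_suml; apply: ler_sum => q _ /=.
  by rewrite mulrC; exact: artanh_lipschitz.
have -> : artanh (complex.Re (y 0 p)) - artanh (complex.Re (x 0 p)) = (artanh \o X) b - (artanh \o X) a.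
  by rewrite /= /X !clamp_id ?lexx ?ab// ga gb.
apply: (@ac_increment_le_integral _ (artanh \o X) a b) => //.
  move=> t; apply: le_ereal_inf_tmp => _ /= [l _ <-]; by rewrite lee_fin normc_ge0.
move=> t tab dh.
apply: le_trans (@kobayashi_metric_ge _ _ Om p (g t) (curve_deriv g t) Om1).
rewrite lee_fin.
have tab' : a <= t <= b by case/andP: tab => ? ?; rewrite !ltW.
have Xt : X t = complex.Re (g t 0 p) by rewrite /X clamp_id.
(* Differentiability is known for artanh X, not for X, so X is written as a function of it. *)
have Xtanh : X = tanh2 \o (artanh \o X).
  by apply/funext => u /=; rewrite artanhK// -ltr_norml.
have dX : is_derive t 1 X ((1 - X t ^+ 2) * derive1 (artanh \o X) t).
  have K : is_derive ((artanh \o X) t) 1 tanh2 (1 - X t ^+ 2).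
    by have := is_derive_tanh2 (artanh (X t)); rewrite artanhK// -ltr_norml.
  have D : is_derive t 1 (artanh \o X) (derive1 (artanh \o X) t) by split => //; rewrite derive1E.
  by have := is_derive1_comp K D; rewrite -Xtanh.
have dRe : derive1 (fun s => complex.Re (g s 0 p)) t = (1 - X t ^+ 2) * derive1 (artanh \o X) t.
  have near_tX : \forall s \near t, X s = complex.Re (g s 0 p).
    have : \forall s \near t, s \in `]a, b[ by apply: near_in_itvoo; rewrite in_itv/=.
    by apply: filterS => s; rewrite in_itv/= => /andP[? ?]; rewrite /X clamp_id// !ltW.
  by have [_ <-] := near_eq_is_derive near_tX dX; rewrite derive1E.
have z1 : normc (g t 0 p) < 1 by apply/Om1/gOm.
have den : 0 < 1 - normc (g t 0 p) ^+ 2 by rewrite subr_gt0 expr_lt1 ?normc_ge0.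
rewrite ler_pdivlMr//.
(* Only the real part of the velocity enters; its imaginary part may be a default value at [t]. *)
apply: le_trans (normRe_le _); rewrite mxE [complex.Re _]/= dRe normrM mulrC.
apply: ler_wpM2r => //; apply: le_trans (ler_norm _).
by rewrite Xt lerD2l lerN2 -real_normK ?num_real// ler_sqr ?nnegrE ?normc_ge0// normRe_le.
Qed.

End kobayashi_lower_bound.

(** * Upper bound for the Kobayashi distance *)

Section holomorphic_discs.
Context {R : realType}.

Lemma normc_real (t : R) : normc t%:C = `|t|.
Proof. by rewrite /= expr0n addr0 sqrtr_sqr. Qed.

Lemma is_derive_disc_comp n (phi : R[i] -> 'rV[R[i]]_n) (m : R[i] -> R[i]) (z dm : R[i]) :
  is_derive z 1 m dm -> derivable phi (m z) 1 ->
  is_derive z 1 (phi \o m) (dm *: 'D_1 phi (m z)).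
Proof.
move=> [/derivable1_diffP diffm mE] /derivable1_diffP diffphi.
have diffpm := differentiable_comp diffm diffphi.
have E1 := deriveE (1 : R[i]) diffpm; have E2 := deriveE (1 : R[i]) diffm; have E3 := deriveE (1 : R[i]) diffphi.
split; first exact: ((derivable1_diffP _ _).2 diffpm).
rewrite E1 (diff_comp diffm diffphi) /= -E2 mE E3.
rewrite -[X in 'd phi (m z) X]mulr1 -[X in 'd phi (m z) X]/(dm *: (1 : R[i])).
by rewrite linearZ.
Qed.

Lemma is_derive_Re_Im (f : R[i] -> R[i]) (t : R) : derivable f t%:C 1 ->
  derive1 (fun s : R => complex.Re (f s%:C)) t = complex.Re ('D_1 f t%:C) /\
  derive1 (fun s : R => complex.Im (f s%:C)) t = complex.Im ('D_1 f t%:C).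
Proof.
move=> df; split; rewrite derive1E; apply: cvg_lim => //; apply/cvgrPdist_le => e e0.
- have [d d0 Hd] := derivable_approx df e0.
  exists d => //= h; rewrite /ball/= sub0r normrN => hd h0.
  have := Hd h%:C; rewrite normc_real => /(_ hd) K.
  rewrite /GRing.scale/= mulr1 -(ler_pM2r (x := `|h|)) ?normr_gt0// -normrM.
  apply: le_trans K; apply: le_trans (normRe_le _).
  rewrite mulrBl mulrAC mulVf// mul1r -normrN (addrC h) rmorphD/=.
  move: (f _) (f _) ('D_1 f _) => [a b] [a' b'] [p q]; simpc => /=.
  by rewrite le_eqVlt; apply/orP; left; apply/eqP; congr (`|_|); ring.
- have [d d0 Hd] := derivable_approx df e0.
  exists d => //= h; rewrite /ball/= sub0r normrN => hd h0.
  have := Hd h%:C; rewrite normc_real => /(_ hd) K.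
  rewrite /GRing.scale/= mulr1 -(ler_pM2r (x := `|h|)) ?normr_gt0// -normrM.
  apply: le_trans K; apply: le_trans (normIm_le _).
  rewrite mulrBl mulrAC mulVf// mul1r -normrN (addrC h) rmorphD/=.
  move: (f _) (f _) ('D_1 f _) => [a b] [a' b'] [p q]; simpc => /=.
  by rewrite le_eqVlt; apply/orP; left; apply/eqP; congr (`|_|); ring.
Qed.

Lemma Re_Im (z : R[i]) : complex.Re z +i* complex.Im z = z.
Proof. by case: z. Qed.

Lemma curve_deriv_disc n (phi : R[i] -> 'rV[R[i]]_n) (t : R) : derivable phi t%:C 1 ->
  curve_deriv (fun s : R => phi s%:C) t = 'D_1 phi t%:C.
Proof.
move=> dphi; apply/rowP => p; rewrite mxE.
have [df <-] := is_derive_coord p dphi.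
have [-> ->] := is_derive_Re_Im df.
by rewrite Re_Im.
Qed.

Definition moebius (t u : R[i]) : R[i] := (u + t) / (1 + t^*%C * u).

Lemma moebius_den (t u : R[i]) : normc t < 1 -> normc u < 1 -> 1 + t^*%C * u != 0.
Proof.
move=> t1 u1; rewrite addrC addr_eq0; apply/eqP => /(congr1 (@normc R)).
rewrite normcN normc1 normcM normc_conj => E.
have : normc t * normc u < 1; last by lra.
by rewrite mulr_ilt1 ?normc_ge0.
Qed.

Lemma moebius_disc (t u : R[i]) : normc t < 1 -> normc u < 1 -> normc (moebius t u) < 1.
Proof.
move=> t1 u1; rewrite /moebius normcM normcV ltr_pdivrMr ?mul1r ?normc_gt0 ?moebius_den//.
rewrite -ltr_sqr ?nnegrE ?normc_ge0// -subr_gt0.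
have := moebius_sqr (- t) u; rewrite opprK normcN rmorphN/= mulNr opprK => ->.
by rewrite mulr_gt0// subr_gt0 expr_lt1 ?normc_ge0.
Qed.

Lemma is_derive_moebius (t u : R[i]) : normc t < 1 -> normc u < 1 ->
  is_derive u 1 (moebius t) ((1 - t^*%C * t) / (1 + t^*%C * u) ^+ 2).
Proof.
move=> t1 u1; have den := moebius_den t1 u1.
have d1 : is_derive u 1 (fun x : R[i] => x + t) (1 + 0) by exact: is_deriveD.
have d2 : is_derive u 1 (fun x : R[i] => 1 + t^*%C * x) (0 + t^*%C *: 1).
  by apply: is_deriveD.
have d3 : is_derive u 1 (fun x : R[i] => (1 + t^*%C * x)^-1) (- (1 + t^*%C * u) ^- 2 *: (0 + t^*%C *: 1)).
  have [dd dE] := d2; split; first exact: derivableV.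
  by rewrite deriveV// dE.
have d4 := is_deriveM d1 d3.
apply: is_derive_eq; rewrite /GRing.scale/=; field.
exact: den.
Qed.

(** Precomposing [phi] with the automorphism [moebius t] gives a disc centred at [phi t] with
    derivative (1 - t^2) phi'(t), so 1 / (1 - t^2) is an admissible multiplier. *)
Lemma kobayashi_metric_disc_le n (Om : set 'rV[R[i]]_n) (phi : R[i] -> 'rV[R[i]]_n) (t : R) :
  (forall u, normc u < 1 -> derivable phi u 1) ->
  (forall u, normc u < 1 -> Om (phi u)) -> `|t| < 1 ->
  (kobayashi_metric Om (phi t%:C) ('D_1 phi t%:C) <= ((1 - t ^+ 2)^-1)%:E)%E.
Proof.
move=> dphi phiOm t1; apply: ereal_inf_lbound.
have t2 : 0 < 1 - t ^+ 2 by rewrite subr_gt0 -real_normK ?num_real// expr_lt1.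
have tc1 : normc t%:C < 1 by rewrite normc_real.
have n0 : normc (0 : R[i]) < 1 by rewrite normc0.
have m0 : moebius t%:C 0 = t%:C by rewrite /moebius add0r mulr0 addr0 divr1.
have dm u : normc u < 1 -> is_derive u 1 (phi \o moebius t%:C)
    ((1 - t%:C^*%C * t%:C) / (1 + t%:C^*%C * u) ^+ 2 *: 'D_1 phi (moebius t%:C u)).
  move=> u1; apply: is_derive_disc_comp; first exact: is_derive_moebius.
  by apply/dphi/moebius_disc.
exists ((1 - t ^+ 2)^-1)%:C => /=; last by rewrite expr0n addr0 sqrtr_sqr gtr0_norm// invr_gt0.
exists (phi \o moebius t%:C); split.
- by move=> u; rewrite normc_lt1 => /dm [].
- by move=> u; rewrite normc_lt1 => u1; apply/phiOm/moebius_disc.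
- by rewrite /= m0.
- rewrite derive1E; have [_ ->] := dm _ n0; rewrite m0 mulr0 addr0 expr1n divr1 scalerA.
  have -> : (1 - t%:C^*%C * t%:C) = (1 - t ^+ 2)%:C.
    by simpc; rewrite expr2.
  by rewrite -rmorphM/= mulVf ?gt_eqF// scale1r.
Qed.

Lemma continuous_artanh (t : R) : `|t| < 1 -> {for t, continuous artanh}.
Proof.
rewrite ltr_norml => t1; apply/differentiable_continuous/derivable1_diffP.
by case: (is_derive_artanh t1).
Qed.

Lemma integral_artanh (s t : R) : -1 < s -> s < t -> t < 1 ->
  (\int[lebesgue_measure]_(x in `[s, t]) ((1 - x ^+ 2)^-1)%:E = (artanh t - artanh s)%:E)%E.
Proof.
move=> s1 st t1; rewrite (continuous_FTC2 (F := artanh)) ?EFinB//.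
- apply: continuous_in_subspaceT => x; rewrite inE/= in_itv/= => /andP[sx xt].
  have x2 : 1 - x ^+ 2 != 0.
    by rewrite subr_eq0 eq_sym -real_normK ?num_real// lt_eqF// expr_lt1// ltr_norml; lra.
  apply: (@continuousV _ _ (fun y : R => 1 - y ^+ 2)) => //.
  apply: continuousB; first exact: cst_continuous.
  exact: exprn_continuous.
- have ca x : s <= x <= t -> {for x, continuous artanh}.
    by move=> sxt; apply: continuous_artanh; rewrite ltr_norml; lra.
  split.
  + move=> x; rewrite in_itv/= => sxt.
    by have [] : is_derive x 1 artanh (1 - x ^+ 2)^-1 by apply: is_derive_artanh; lra.
  + by apply: cvg_at_right_filter; apply: ca; lra.
  + by apply: cvg_at_left_filter; apply: ca; lra.
- move=> x; rewrite in_itv/= => sxt; rewrite derive1E.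
  by have [_ ] : is_derive x 1 artanh (1 - x ^+ 2)^-1 by apply: is_derive_artanh; lra.
Qed.

(** The real segment [s, t] is a Poincare geodesic, and [phi] does not increase its length. *)
Lemma kobayashi_edist_disc_le n (Om : set 'rV[R[i]]_n) (phi : R[i] -> 'rV[R[i]]_n) (s t : R) :
  (forall u, normc u < 1 -> derivable phi u 1) ->
  (forall u, normc u < 1 -> Om (phi u)) -> -1 < s -> s < t -> t < 1 ->
  abs_continuous s t (fun x : R => phi x%:C) ->
  (kobayashi_edist Om (phi s%:C) (phi t%:C) <= (artanh t - artanh s)%:E)%E.
Proof.
move=> dphi phiOm s1 st t1 acphi.
have x1 x : s <= x <= t -> `|x| < 1 by move=> sxt; rewrite ltr_norml; lra.
apply: (@le_trans _ _ (kobayashi_length Om s t (fun x : R => phi x%:C))).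
  apply: ereal_inf_lbound; exists s, t, (fun x : R => phi x%:C); split => //; first exact: ltW.
  by move=> x sxt; apply: phiOm; rewrite normc_real x1.
rewrite -integral_artanh// /kobayashi_length.
apply: le_lower_integral.
- move=> x _; apply: le_ereal_inf_tmp => _ /= [l _ <-]; by rewrite lee_fin normc_ge0.
- move=> x /=; rewrite in_itv/= => /x1 xx.
  by rewrite lee_fin invr_ge0 subr_ge0 -real_normK ?num_real// expr_le1// ltW.
- move=> x /= xst; split => //; move: xst; rewrite in_itv/= => /x1 xx.
  rewrite curve_deriv_disc; first exact: kobayashi_metric_disc_le.
  by apply: dphi; rewrite normc_real.
Qed.

End holomorphic_discs.

Lemma normc_realB (R : realType) (x y : R) : normc (x%:C - y%:C) = `|x - y|.
Proof. by rewrite -normc_real; congr normc; rewrite rmorphB. Qed.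

(** * Explicit discs in a scaled polydisc *)

Section polydisc.
Context {R : realType} {n : nat}.
Variables (Om : set 'rV[R[i]]_n) (c : R).
Hypothesis polydisc_sub : forall u : 'rV[R[i]]_n,
  (forall k, normc (u 0 k) < 1) -> Om (c%:C *: u).

Lemma lipschitz_abs_continuous (g : R -> 'rV[R[i]]_n) (s t L : R) : 0 <= L ->
  (forall x y, s <= x -> x <= y -> y <= t -> `|g y - g x| <= (L * (y - x))%:C) ->
  abs_continuous s t g.
Proof.
move=> L0 gL e' e'0; have [eE e0] := gt0_complexE e'0; rewrite eE.
have L1 : 0 < L + 1 by rewrite ltr_wpDl.
exists (complex.Re e' / (L + 1)); first by rewrite divr_gt0.
move=> m u v uv _ uvd.
apply: (@le_lt_trans _ _ (\sum_i (L * (v i - u i)))%:C).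
  by rewrite rmorph_sum/=; apply: ler_sum => i _; have [? ? ?] := uv i; exact: gL.
rewrite ltcR -mulr_sumr; rewrite ltr_pdivlMr// in uvd.
apply: le_lt_trans uvd; rewrite mulrC ler_wpM2l ?lerDl//.
by apply: sumr_ge0 => i _; have [_ ? _] := uv i; rewrite subr_ge0.
Qed.

Lemma kobayashi_edist_polydisc_le (Phi : 'I_n -> R[i] -> R[i]) (s t L : R) : 0 <= L ->
  (forall k u, normc u < 1 -> derivable (Phi k) u 1) ->
  (forall k u, normc u < 1 -> normc (Phi k u) < 1) ->
  (forall k x y, s <= x -> x <= y -> y <= t -> normc (Phi k y%:C - Phi k x%:C) <= L * (y - x)) ->
  -1 < s -> s < t -> t < 1 ->
  (kobayashi_edist Om (c%:C *: \row_k Phi k s%:C) (c%:C *: \row_k Phi k t%:C)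
    <= (artanh t - artanh s)%:E)%E.
Proof.
move=> L0 dPhi Phi1 PhiL s1 st t1.
apply: (@kobayashi_edist_disc_le _ _ Om (fun u => c%:C *: \row_k Phi k u)) => //.
- move=> u u1; have [] // : is_derive u 1 (fun u => c%:C *: \row_k Phi k u) (\row_k (c%:C * 'D_1 (Phi k) u)).
  apply: is_derive_row => p; rewrite mxE.
  rewrite (_ : (fun x => _) = c%:C \*: Phi p); last by apply/funext => x; rewrite !mxE.
  by have /derivableP := dPhi p _ u1; exact: is_deriveZ.
- by move=> u u1; apply: polydisc_sub => k; rewrite mxE; exact: Phi1.
- apply: (@lipschitz_abs_continuous _ _ _ (`|c| * L)); first by rewrite mulr_ge0.
  move=> x y sx xy yt; apply: normr_row_le.
    by rewrite lecR mulr_ge0 ?mulr_ge0// subr_ge0.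
  move=> p; rewrite !mxE -mulrBr normc_le normcM normc_real -mulrA ler_wpM2l//.
  exact: PhiL.
Qed.

Definition axis (p : 'I_n) (x : R) : 'rV[R[i]]_n := x%:C *: delta_mx 0 p.

Lemma axisE p x k : axis p x 0 k = (if k == p then x else 0)%:C.
Proof. by rewrite !mxE/=; case: (k == p); rewrite ?mulr1 ?mulr0. Qed.

(** Used for finiteness: it lets the lower bound between opposite points pass from [kobayashi_edist]
    to [kobayashi_dist]. *)
Lemma kobayashi_edist_diameter_le (p : 'I_n) (a : R) : 0 < a < 1 ->
  (kobayashi_edist Om (axis p (- (c * a))) (axis p (c * a))
    <= (artanh a - artanh (- a))%:E)%E.
Proof.
move=> /andP[a0 a1].
have := @kobayashi_edist_polydisc_le (fun k u => if k == p then u else 0) (- a) a 1 ler01.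
rewrite (_ : c%:C *: \row_k _ = axis p (- (c * a))); last first.
  by apply/rowP => k; rewrite axisE !mxE; case: (k == p); rewrite -?rmorphM ?mulrN ?mulr0.
rewrite (_ : c%:C *: \row_k _ = axis p (c * a)); last first.
  by apply/rowP => k; rewrite axisE !mxE; case: (k == p); rewrite -?rmorphM ?mulrN ?mulr0.
apply; try lra.
- move=> k u u1; case: (k == p); [exact: derivable_id|exact: derivable_cst].
- by move=> k u u1; case: (k == p); rewrite ?normc0.
- move=> k x y ax xy ya; case: (k == p); rewrite mul1r ?subrr ?normc0 ?subr_ge0//.
  by rewrite normc_realB ger0_norm// subr_ge0.
Qed.

(* The image of [0, a] under the disc u |-> (s (a - u) / (1 - a u), t u) is a geodesic of the
   bidisc that joins the two axes. *)
Lemma kobayashi_edist_quarter_le (p q : 'I_n) (a s t : R) : p != q -> 0 < a < 1 ->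
  `|s| = 1 -> `|t| = 1 ->
  (kobayashi_edist Om (axis p (s * (c * a))) (axis q (t * (c * a)))
    <= (artanh a)%:E)%E.
Proof.
move=> pq /andP[a0 a1] s1 t1.
have na1 : normc (- a)%:C < 1 by rewrite normc_real normrN gtr0_norm.
have a2 : 0 < 1 - a ^+ 2 by rewrite subr_gt0 expr_lt1// ltW.
have MR x : moebius (- a)%:C x%:C = ((x - a) / (1 - a * x))%:C.
  rewrite /moebius conjc_real -rmorphM -!rmorphD/= -fmorphV -rmorphM.
  by rewrite mulNr.
pose Phi k u := if k == p then (- s)%:C * moebius (- a)%:C u else if k == q then t%:C * u else 0.
(* On [0, a] the difference quotients of the automorphism are (1 - a^2) / ((1 - a x) (1 - a y)) in
   absolute value, at most 1 / (1 - a^2). *)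
have := @kobayashi_edist_polydisc_le Phi 0 a (1 - a ^+ 2)^-1.
have artanh0 : artanh 0 = 0 :> R by rewrite /artanh addr0 subr0 divr1 ln1 mul0r.
rewrite artanh0 subr0.
rewrite (_ : c%:C *: \row_k _ = axis p (s * (c * a))); last first.
  apply/rowP => k; rewrite axisE !mxE /Phi; case: eqP => _.
    by rewrite MR mulr0 subr0 divr1 sub0r -!rmorphM/=; congr (_%:C); ring.
  by case: eqP; rewrite ?mulr0.
rewrite (_ : c%:C *: \row_k _ = axis q (t * (c * a))); last first.
  apply/rowP => k; rewrite axisE !mxE /Phi; case: (eqVneq k p) => [->|kp].
    by rewrite (negbTE pq) MR subrr mul0r mulr0 mulr0.
  by case: eqP => _; rewrite ?mulr0// -!rmorphM/=; congr (_%:C); ring.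
apply; rewrite ?invr_ge0; try lra.
- move=> k u u1; rewrite /Phi; case: eqP => _.
    apply: (@derivableZ _ _ _ (moebius (- a)%:C) (- s)%:C).
    by have [] := is_derive_moebius na1 u1.
  case: eqP => _; last exact: derivable_cst.
  by apply: (@derivableZ _ _ _ id t%:C); exact: derivable_id.
- move=> k u u1; rewrite /Phi; case: eqP => _.
    by rewrite normcM normc_real normrN s1 mul1r; exact: moebius_disc.
  by case: eqP => _; rewrite ?normc0// normcM normc_real t1 mul1r.
- move=> k x y x0 xy ya; rewrite /Phi; case: eqP => _.
    rewrite -mulrBr normcM normc_real normrN s1 mul1r !MR normc_realB.
    have ax : 1 - a ^+ 2 <= 1 - a * x by rewrite lerD2l lerN2 expr2 ler_pM2l//; lra.
    have ay : 1 - a ^+ 2 <= 1 - a * y by rewrite lerD2l lerN2 expr2 ler_pM2l//; lra.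
    have ax0 := lt_le_trans a2 ax; have ay0 := lt_le_trans a2 ay.
    have -> : (y - a) / (1 - a * y) - (x - a) / (1 - a * x) =
      (1 - a ^+ 2) / (1 - a * y) / (1 - a * x) * (y - x) by field; rewrite !gt_eqF.
    rewrite normrM [`|y - x|]ger0_norm ?subr_ge0// ler_wpM2r ?subr_ge0//.
    rewrite ger0_norm; last by rewrite divr_ge0 ?divr_ge0 ?ltW.
    rewrite ler_pdivrMr// -ler_pdivrMl ?invr_gt0// invrK.
    rewrite mulrA -expr2 ler_pdivrMr//.
    by rewrite expr2 ler_pM// ltW.
  case: eqP => _; last by rewrite subrr normc0 mulr_ge0 ?subr_ge0// invr_ge0 ltW.
  rewrite -mulrBr normcM normc_real t1 mul1r normc_realB ger0_norm ?subr_ge0//.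
  rewrite ler_peMl ?subr_ge0// invf_ge1// gerBl sqr_ge0//.
Qed.

End polydisc.

(** * Divergence of the hyperbolicity constants *)

Section Omega_polydisc.
Context {R : realType} {n : nat}.

Lemma powR_root (x : R) j : (0 < j)%N -> 0 <= x -> (x ^+ j) `^ j%:R^-1 = x.
Proof.
move=> j0 x0; rewrite -powR_mulrn// -powRrM divff ?powRr1//.
by rewrite pnatr_eq0 -lt0n.
Qed.

Lemma sqr_normc_le_F j (z : 'rV[R[i]]_n) p : (0 < j)%N -> normc (z 0 p) ^+ 2 <= F n j z.
Proof.
move=> j0; rewrite /F -[leLHS](@powR_root _ j)// -?exprM ?sqr_ge0//.
rewrite ler_wpDr//; first by rewrite mulr_ge0// sumr_ge0// => k _; rewrite sqr_ge0.
apply: ge0_ler_powR; rewrite ?invr_ge0 ?nnegrE ?exprn_ge0 ?normc_ge0//.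
  by apply: sumr_ge0 => k _; rewrite exprn_ge0 ?normc_ge0.
rewrite (bigD1 p)//= lerDl.
by apply: sumr_ge0 => k _; rewrite exprn_ge0 ?normc_ge0.
Qed.

Lemma Omega_polydisc j (z : 'rV[R[i]]_n) p : (0 < j)%N -> Omega R n j z -> normc (z 0 p) < 1.
Proof.
move=> j0 zO; rewrite -(@expr_lt1 _ 2) ?normc_ge0//.
exact: le_lt_trans (sqr_normc_le_F z p j0) zO.
Qed.

Lemma bernoulli (x : R) j : 0 <= x -> 1 + x *+ j <= (1 + x) ^+ j.
Proof.
move=> x0; elim: j => [|j ih]; first by rewrite mulr0n addr0 expr0.
rewrite exprS; apply: le_trans (ler_wpM2l _ ih); last by rewrite addr_ge0.
have : 0 <= x * (x *+ j) by rewrite mulr_ge0// mulrn_wge0.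
by rewrite mulrS; lra.
Qed.

Lemma powR_root_natr_le (m j : nat) : (0 < j)%N -> m%:R `^ j%:R^-1 <= 1 + m%:R / j%:R :> R.
Proof.
move=> j0; have j0' : j%:R != 0 :> R by rewrite pnatr_eq0 -lt0n.
have r0 : 0 <= 1 + m%:R / j%:R :> R by rewrite addr_ge0// divr_ge0.
rewrite -[leRHS](@powR_root _ j)//.
apply: ge0_ler_powR; rewrite ?invr_ge0 ?nnegrE ?exprn_ge0//.
apply: le_trans (bernoulli j (_ : 0 <= m%:R / j%:R)); last by rewrite divr_ge0.
by rewrite -[_ / _ *+ _]mulr_natr divfK// lerDr.
Qed.

(** Bernoulli gives n^(1/j) <= 1 + n/j, so the first summand of F_j is at most c^2 (1 + n/j); the
    second is strictly below c^2 n/j. *)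
Lemma polydisc_Omega j (c : R) (u : 'rV[R[i]]_n) : (0 < n)%N -> (0 < j)%N -> 0 < c ->
  c ^+ 2 * (1 + n%:R / j%:R *+ 2) <= 1 ->
  (forall k, normc (u 0 k) < 1) -> Omega R n j (c%:C *: u).
Proof.
move=> n0 j0 c0 cn u1; rewrite /Omega/= /F.
have nu k : normc ((c%:C *: u) 0 k) = c * normc (u 0 k).
  by rewrite mxE normcM normc_real gtr0_norm.
have c2 : 0 < c ^+ 2 by rewrite exprn_gt0.
apply: (@lt_le_trans _ _ (c ^+ 2 * n%:R `^ j%:R^-1 + j%:R^-1 * (c ^+ 2 * n%:R))).
  apply: ler_ltD.
    have -> : c ^+ 2 * n%:R `^ j%:R^-1 = ((c ^+ 2) ^+ j * n%:R) `^ j%:R^-1.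
      by rewrite [RHS]powRM; [rewrite powR_root ?(ltW c2)|rewrite exprn_ge0 ?(ltW c2)|].
    apply: ge0_ler_powR; rewrite ?invr_ge0 ?nnegrE//.
    + by apply: sumr_ge0 => k _; rewrite exprn_ge0 ?normc_ge0.
    + by rewrite mulr_ge0// !exprn_ge0// ltW.
    + rewrite -exprM mulr_natr -[X in _ *+ X](card_ord n) -sumr_const; apply: ler_sum => k _.
      rewrite nu exprMn ler_piMr ?exprn_ge0 ?(ltW c0)//.
      by rewrite exprn_ile1 ?normc_ge0// ltW.
  rewrite ltr_pM2l ?invr_gt0 ?ltr0n// mulr_natr -[X in _ *+ X](card_ord n) -sumr_const.
  rewrite (bigD1 (Ordinal n0))//= [ltRHS](bigD1 (Ordinal n0))//=; apply: ltr_leD.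
    by rewrite nu exprMn gtr_pMr// expr_lt1 ?normc_ge0.
  by apply: ler_sum => k _; rewrite nu exprMn ler_piMr ?(ltW c2)// expr_le1 ?normc_ge0// ltW.
apply: le_trans cn; rewrite mulrCA -mulrDr ler_pM2l//.
have := powR_root_natr_le n j0; rewrite (mulrC j%:R^-1) mulr2n; lra.
Qed.

End Omega_polydisc.

Section hyperbolicity.
Context {R : realType} {n : nat}.

Lemma artanhN (t : R) : artanh (- t) = - artanh t.
Proof.
rewrite /artanh opprK -mulNr; congr (_ * _).
have [t1|t1] := boolP ((1 + t) / (1 - t) > 0).
  by rewrite -lnV ?posrE// invf_div.
rewrite -leNgt in t1; rewrite (ln0 t1) oppr0 ln0//.
by rewrite -invf_div invr_le0.
Qed.

Lemma fin_num_between (e : \bar R) (a b : R) : (a%:E <= e)%E -> (e <= b%:E)%E ->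
  a <= fine e <= b.
Proof. by case: e => [r| |]//=; rewrite !lee_fin => -> ->. Qed.

(** Whichever product attains the minimum, the distance it shares with the left-hand product
    cancels. What remains is half of the two diagonals minus two sides, at least half of 4 artanh (c
    a) - 2 artanh a. *)
Lemma hyperbolic_Omega_ge (j : nat) (c a delta : R) : (2 <= n)%N -> (0 < j)%N ->
  0 < c -> c ^+ 2 * (1 + n%:R / j%:R *+ 2) <= 1 -> 0 < a < 1 ->
  gromov_hyperbolic (Omega R n j) (kobayashi_dist (Omega R n j)) delta ->
  artanh (c * a) *+ 2 - artanh a <= delta.
Proof.
move=> n2 j0 c0 cn a01 hyp; have n0 : (0 < n)%N by exact: leq_trans n2.
pose p : 'I_n := Ordinal n0; pose q : 'I_n := Ordinal n2.
have /andP[a0 a1] := a01.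
have sub u := @polydisc_Omega R n j c u n0 j0 c0 cn.
have inO r (s : R) : `|s| = 1 -> Omega R n j (axis r (s * (c * a))).
  move=> s1; rewrite (_ : axis r _ = c%:C *: axis r (s * a)).
    apply: sub => k; rewrite axisE normc_real; case: (k == r); rewrite ?normr0//.
    by rewrite normrM s1 mul1r gtr0_norm.
  by rewrite /axis scalerA -rmorphM/= mulrCA.
have N1 : `|-1| = 1 :> R by rewrite normrN1.
have P1 : `|1| = 1 :> R by rewrite normr1.
pose d := kobayashi_dist (Omega R n j).
have opp r : artanh (c * a) *+ 2 <= d (axis r (-1 * (c * a))) (axis r (1 * (c * a))).
  have lo := @kobayashi_edist_ge R n (Omega R n j) r (axis r (-1 * (c * a))) (axis r (1 * (c * a)))
    (fun w => Omega_polydisc r j0).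
  rewrite !axisE eqxx /= mulN1r mul1r artanhN opprK -mulr2n in lo.
  have up := kobayashi_edist_diameter_le sub r a01.
  by rewrite mulN1r mul1r; have /andP[] := fin_num_between lo up.
have adj r r' s t : r != r' -> `|s| = 1 -> `|t| = 1 ->
    d (axis r (s * (c * a))) (axis r' (t * (c * a))) <= artanh a.
  move=> rr' s1 t1.
  have lo := @kobayashi_edist_ge R n (Omega R n j) r (axis r (s * (c * a))) (axis r' (t * (c * a)))
    (fun w => Omega_polydisc r j0).
  by have /andP[] := fin_num_between lo (kobayashi_edist_quarter_le sub rr' a01 s1 t1).
have pq : p != q by [].
have qp : q != p by [].
(* The points are assigned so that each distance in the Gromov products occurs with its arguments in
   the order of [opp] and [adj], without appeal to symmetry. *)
have := hyp (axis p (1 * (c * a))) (axis q (-1 * (c * a))) (axis p (-1 * (c * a))) (axis q (1 * (c * a)))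
  (inO _ _ P1) (inO _ _ N1) (inO _ _ N1) (inO _ _ P1).
move: (opp p) (opp q) (adj _ _ _ _ qp N1 N1) (adj _ _ _ _ qp P1 P1)
  (adj _ _ _ _ qp N1 P1) (adj _ _ _ _ pq N1 P1).
rewrite /gromov_product -/d.
move: (axis p (1 * _)) (axis p (-1 * _)) (axis q (1 * _)) (axis q (-1 * _)) => o y z x.
move: (artanh _) (artanh _) => A B.
move: (d x o) (d z o) (d x z) (d y o) (d x y) (d y z) => xo zo xz yo xy yz.
rewrite /Num.min; case: ifP => _; lra.
Qed.

Lemma hyperbolicity_constant_Omega_cvg : (2 <= n)%N ->
  (fun j : nat => hyperbolicity_constant (Omega R n j) (kobayashi_dist (Omega R n j)))
    @ \oo --> +oo%E.
Proof.
move=> n2; apply/cvgeyPge => M.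
pose X := expR `|M|; have X1 : 1 <= X by rewrite /X -expR0 ler_expR.
have X0 : 0 < X by exact: lt_le_trans X1.
(* With a = 1 - k and c a = 1 - 2k the logarithms in artanh are those of 16 X^2 - 1 and 8 X^2 - 1,
   and ln (4 X^2) - ln (16 X^2) / 2 = ln X = |M|. Neither a nor c depends on j, so j can be taken
   large afterwards. *)
pose k := (8 * X ^+ 2)^-1.
have X2 : 1 <= X ^+ 2 by rewrite exprn_ege1.
have k0 : 0 < k by rewrite invr_gt0 mulr_gt0// exprn_gt0.
have k8 : k <= 8^-1 by rewrite lef_pV2 ?posrE; lra.
pose c := (1 - k *+ 2) / (1 - k).
have kk : 0 < 1 - k by lra.
have ca : c * (1 - k) = 1 - k *+ 2 by rewrite divfK// gt_eqF.
have c0 : 0 < c by rewrite divr_gt0//; lra.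
have c1 : c < 1 by rewrite ltr_pdivrMr//; lra.
have c2 : 0 < 1 - c ^+ 2 by rewrite subr_gt0 expr_lt1// ltW.
have n0 : (0 < n)%N by exact: leq_trans n2.
have [N Nn] : exists N : nat, n%:R *+ 2 / (1 - c ^+ 2) < N%:R :> R.
  by exists (Num.truncn (n%:R *+ 2 / (1 - c ^+ 2)) : nat).+1; exact: truncnS_gt.
near=> j.
have j0 : (0 < j)%N by near: j; exact: nbhs_infty_gt.
have jn : n%:R *+ 2 / (1 - c ^+ 2) < j%:R :> R.
  apply: (lt_le_trans Nn); rewrite ler_nat; near: j; exact: nbhs_infty_ge.
have cj : c ^+ 2 * (1 + n%:R / j%:R *+ 2) <= 1.
  have j0' : 0 < j%:R :> R by rewrite ltr0n.
  have : n%:R / j%:R *+ 2 <= 1 - c ^+ 2.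
    by rewrite -mulrnAl ler_pdivrMr// mulrC -ler_pdivrMr// ltW.
  move=> H; have : c ^+ 2 * (n%:R / j%:R *+ 2) <= 1 * (n%:R / j%:R *+ 2).
    by rewrite ler_wpM2r ?mulrn_wge0 ?divr_ge0//; lra.
  by rewrite mulrDr; lra.
apply: le_ereal_inf_tmp => _ /= [delta [d0 hyp] <-]; rewrite lee_fin.
have := @hyperbolic_Omega_ge j c (1 - k) delta n2 j0 c0 cj _ hyp.
rewrite ca => H; apply: le_trans (H _); last by lra.
have lnX : ln X = `|M| by rewrite /X expRK.
have kX : k^-1 = 8 * X ^+ 2 by rewrite invrK.
have kn0 : k != 0 by rewrite gt_eqF.
have AE : (1 + (1 - k *+ 2)) / (1 - (1 - k *+ 2)) = 8 * X ^+ 2 - 1.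
  rewrite -kX (_ : 1 - (1 - k *+ 2) = k *+ 2); last by ring.
  by rewrite mulr2n; field; rewrite kn0 gt_eqF// addr_gt0.
have BE : (1 + (1 - k)) / (1 - (1 - k)) = 16 * X ^+ 2 - 1.
  have -> : 16 * X ^+ 2 = 2 * (8 * X ^+ 2) by ring.
  by rewrite -kX (_ : 1 - (1 - k) = k); [field|ring].
rewrite /artanh AE BE.
have X20 : 0 < X ^+ 2 by rewrite exprn_gt0.
have lnA : ln (4 * X ^+ 2) <= ln (8 * X ^+ 2 - 1) by rewrite ler_ln ?posrE; lra.
have lnB : ln (16 * X ^+ 2 - 1) <= ln (16 * X ^+ 2) by rewrite ler_ln ?posrE; lra.
have : ln (4 * X ^+ 2) *+ 2 = ln (16 * X ^+ 2) + ln X *+ 2.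
  rewrite -!lnXn ?mulr_gt0// -lnM ?posrE ?mulr_gt0//; congr ln; ring.
have := ler_norm M; rewrite lnX; lra.
Unshelve. all: by end_near. Qed.

End hyperbolicity.

(** * Strong convexity of the domains *)

Section expressions.
Context {R : realType} {m : nat}.
Implicit Types (w x : 'rV[R]_m) (a b : 'I_m).

(* Closed under partial derivatives, hence a convenient supply of smooth functions. *)
Inductive rexpr :=
| Cst of R
| Var of 'I_m
| Add of rexpr & rexpr
| Mul of rexpr & rexpr
| Exp of rexpr & nat
| Pow of rexpr & R
| Sum (k : nat) of 'I_k -> rexpr.

Fixpoint eval (e : rexpr) w : R :=
  match e with
  | Cst c => c
  | Var i => w 0 i
  | Add e1 e2 => eval e1 w + eval e2 w
  | Mul e1 e2 => eval e1 w * eval e2 w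
  | Exp e1 k => eval e1 w ^+ k
  | Pow e1 r => eval e1 w `^ r
  | Sum k f => \sum_(i < k) eval (f i) w
  end.

(** A real power is differentiated only at a positive base; natural powers have their own
    constructor and are smooth everywhere. *)
Fixpoint regular (e : rexpr) w : Prop :=
  match e with
  | Cst _ | Var _ => True
  | Add e1 e2 | Mul e1 e2 => regular e1 w /\ regular e2 w
  | Exp e1 _ => regular e1 w
  | Pow e1 _ => regular e1 w /\ 0 < eval e1 w
  | Sum k f => forall i, regular (f i) w
  end.

Fixpoint pdiff (a : 'I_m) (e : rexpr) : rexpr :=
  match e with
  | Cst _ => Cst 0
  | Var i => Cst (i == a)%:R
  | Add e1 e2 => Add (pdiff a e1) (pdiff a e2)
  | Mul e1 e2 => Add (Mul (pdiff a e1) e2) (Mul e1 (pdiff a e2))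
  (* At k = 0 the truncated exponent is multiplied by 0. *)
  | Exp e1 k => Mul (Mul (Cst k%:R) (Exp e1 k.-1)) (pdiff a e1)
  | Pow e1 r => Mul (Mul (Cst r) (Pow e1 (r - 1))) (pdiff a e1)
  | Sum k f => Sum (fun i => pdiff a (f i))
  end.

Lemma regular_pdiff a e w : regular e w -> regular (pdiff a e) w.
Proof.
by elim: e => //= [e1 ih1 e2 ih2 []|e1 ih1 e2 ih2 []|e1 ih1 _|e1 ih1 _ []|k f ih H i];
  intuition.
Qed.

Lemma derive_line (f : 'rV[R]_m -> R) w (v : 'rV[R]_m) :
  'D_1 (fun h : R => f (h *: v + w)) 0 = 'D_v f w.
Proof.
rewrite /derive; set g1 := fun h => h^-1 *: _; set g2 := fun h => h^-1 *: _.
suff -> : g1 = g2 by [].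
by rewrite funeqE /g1 /g2 => h /=; rewrite addr0 scale0r add0r [_%:A]mulr1.
Qed.

Lemma is_derive_comp_dir (f : 'rV[R]_m -> R) (phi : R -> R) w (v : 'rV[R]_m) (df dphi : R) :
  is_derive w v f df -> is_derive (f w) 1 phi dphi -> is_derive w v (phi \o f) (dphi * df).
Proof.
move=> [/derivable1P fwv <-] dphiw.
have d1 : is_derive (0 : R) 1 (fun h : R => f (h *: v + w)) ('D_v f w).
  by split => //; exact: derive_line.
have d2 : is_derive ((fun h : R => f (h *: v + w)) 0) 1 phi dphi by rewrite scale0r add0r.
have [d3 E3] := is_derive1_comp d2 d1.
split; first by apply/derivable1P; exact: d3.
by rewrite -derive_line -E3.
Qed.

Lemma is_derive_eval a e w : regular e w ->
  is_derive w (delta_mx 0 a) (eval e) (eval (pdiff a e) w).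
Proof.
elim: e => /= [c _|i _|e1 ih1 e2 ih2 [/ih1 d1 /ih2 d2]|e1 ih1 e2 ih2 [/ih1 d1 /ih2 d2]|e1 ih1 k /ih1 d1|e1 ih1 r [/ih1 d1 e0]|k f ih H].
- exact: is_derive_cst.
- have H : (fun h : R => h^-1 *: (((fun w => w 0 i) \o shift w) (h *: delta_mx 0 a) - w 0 i)) @ 0^' --> ((i == a)%:R : R).
    apply: (@cvg_trans _ ((fun=> (i == a)%:R : R) @ (0 : R)^')); last exact: cvg_cst.
    apply: near_eq_cvg; near=> h.
    have h0 : h != 0 by near: h; exact: nbhs_dnbhs_neq.
    by rewrite /= !mxE/= addrK /GRing.scale/= mulrA mulVf// mul1r.
  by split; [apply/cvg_ex; exists (i == a)%:R|exact: cvg_lim].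
- exact: is_deriveD.
- rewrite (_ : _ + _ = eval e1 w *: eval (pdiff a e2) w + eval e2 w *: eval (pdiff a e1) w).
    exact: (is_deriveM d1 d2).
  by rewrite /GRing.scale/= addrC [X in _ + X]mulrC.
- rewrite (_ : (fun w => _) = eval e1 ^+ k); first exact: (is_deriveX k d1).
  by apply/funext => x; rewrite exprfctE.
- exact: (is_derive_comp_dir d1 (is_derive1_powR _ e0)).
- rewrite (_ : (fun w => \sum_i _) = \sum_(i < k) eval (f i)); last first.
    by apply/funext => x; rewrite fct_sumE.
  by apply: is_derive_sum => i; exact: ih.
Unshelve. all: by end_near. Qed.

Lemma continuous_eval e w : regular e w -> {for w, continuous (eval e)}.
Proof.
elim: e => /= [c _|i _|e1 ih1 e2 ih2 [/ih1 d1 /ih2 d2]|e1 ih1 e2 ih2 [/ih1 d1 /ih2 d2]|e1 ih1 k /ih1 d1|e1 ih1 r [/ih1 d1 e0]|k f ih H].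
- exact: cst_continuous.
- exact: coord_continuous.
- exact: continuousD.
- exact: continuousM.
- apply: (@continuous_comp _ _ _ (eval e1) (fun y : R => y ^+ k)) => //.
  exact: exprn_continuous.
- apply: (@continuous_comp _ _ _ (eval e1) (fun y : R => y `^ r) w d1).
  apply/differentiable_continuous/derivable1_diffP.
  by have [] := is_derive1_powR r e0.
- apply: (@cvg_big R^o _ +%R 0 xpredT (@add_continuous R^o) _ _ _ (fun i => eval (f i)) (fun i => eval (f i) w)) => [|i _].
    exact: nbhs_filter.
  exact: ih.
Qed.

(** Actual and symbolic derivatives agree only on [U]; since [U] is open they agree near each of its
    points, which suffices to differentiate once more. *)
Lemma smooth_on_eval (U : set 'rV[R]_m) e : open U -> (forall w, U w -> regular e w) ->
  smooth_on U (eval e) /\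
  forall s w, U w -> foldr (@partial R m) (eval e) s w = eval (foldr pdiff e s) w.
Proof.
move=> oU Ue.
have reg s w : U w -> regular (foldr pdiff e s) w.
  by elim: s => [|a s ih] Uw /=; [exact: Ue|exact/regular_pdiff/ih].
have nearU w : U w -> \forall y \near w, U y by move=> Uw; exact: open_nbhs_nbhs.
have E s : forall w, U w -> foldr (@partial R m) (eval e) s w = eval (foldr pdiff e s) w.
  elim: s => [//|a s ih] w Uw /=.
  have [_ <-] := is_derive_eval a (reg s w Uw).
  by apply: near_eq_derive; apply: filterS (nearU w Uw) => y; exact: ih.
split=> // s w Uw /=.
have eqs : \forall y \near w, eval (foldr pdiff e s) y = foldr (@partial R m) (eval e) s y.
  by apply: filterS (nearU w Uw) => y Uy; rewrite E.
split.
  rewrite /prop_for/continuous_at (E _ _ Uw).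
  apply: cvg_trans (continuous_eval (reg s w Uw)); apply: near_eq_cvg.
    exact: nbhs_filter.
  exact: eqs.
move=> a; apply: near_eq_derivable eqs _.
by have [] := is_derive_eval a (reg s w Uw).
Qed.

End expressions.

Section jets.
Context {R : realType} {m : nat}.
Variables (x v : 'rV[R]_m).
Implicit Types e : @rexpr R m.

(** [slope] and [curvature] are the first and second derivatives at [x] in the direction [v]. They
    obey the calculus rules directly, which avoids handling the entries of the Hessian. *)
Definition slope e := \sum_a v 0 a * eval (pdiff a e) x.

Definition curvature e := \sum_a \sum_b v 0 a * v 0 b * eval (pdiff a (pdiff b e)) x.

Lemma slope_Cst c : slope (Cst c) = 0.
Proof. by rewrite /slope big1// => a _; rewrite mulr0. Qed.

Lemma slope_Var i : slope (Var i) = v 0 i.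
Proof.
rewrite /slope (bigD1 i)//= eqxx mulr1 big1 ?addr0// => a /negbTE ai.
by rewrite eq_sym ai mulr0.
Qed.

Lemma slope_Add e1 e2 : slope (Add e1 e2) = slope e1 + slope e2.
Proof. by rewrite /slope -big_split; apply: eq_bigr => a _ /=; ring. Qed.

Lemma slope_scale c e : slope (Mul (Cst c) e) = c * slope e.
Proof. by rewrite /slope mulr_sumr; apply: eq_bigr => a _ /=; ring. Qed.

Lemma slope_Exp e k : slope (Exp e k) = k%:R * eval e x ^+ k.-1 * slope e.
Proof. by rewrite /slope mulr_sumr; apply: eq_bigr => a _ /=; ring. Qed.

Lemma slope_Pow e r : slope (Pow e r) = r * eval e x `^ (r - 1) * slope e.
Proof. by rewrite /slope mulr_sumr; apply: eq_bigr => a _ /=; ring. Qed.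

Lemma slope_Sum k (f : 'I_k -> rexpr) : slope (Sum f) = \sum_i slope (f i).
Proof. by rewrite /slope exchange_big/=; apply: eq_bigr => a _; rewrite mulr_sumr. Qed.

(** The second-order chain rule, with [c1] and [c2] standing for the second and first derivatives of
    the outer function. *)
Lemma curvature_quad e (h : 'I_m -> 'I_m -> R) (c1 c2 : R) :
  (forall a b, h a b = c1 * (eval (pdiff a e) x * eval (pdiff b e) x) + c2 * eval (pdiff a (pdiff b e)) x) ->
  \sum_a \sum_b v 0 a * v 0 b * h a b = c1 * slope e ^+ 2 + c2 * curvature e.
Proof.
move=> hE; rewrite expr2 {1}/slope mulr_suml mulr_sumr /curvature mulr_sumr -big_split/=.
apply: eq_bigr => a _; rewrite /slope mulr_sumr !mulr_sumr -big_split/=.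
by apply: eq_bigr => b _; rewrite hE; ring.
Qed.

Lemma curvature_Cst c : curvature (Cst c) = 0.
Proof. by rewrite /curvature big1// => a _; rewrite big1// => b _; rewrite mulr0. Qed.

Lemma curvature_Var i : curvature (Var i) = 0.
Proof. by rewrite /curvature big1// => a _; rewrite big1// => b _; rewrite mulr0. Qed.

Lemma curvature_Add e1 e2 : curvature (Add e1 e2) = curvature e1 + curvature e2.
Proof.
rewrite /curvature -big_split; apply: eq_bigr => a _.
by rewrite -big_split; apply: eq_bigr => b _ /=; ring.
Qed.

Lemma curvature_scale c e : curvature (Mul (Cst c) e) = c * curvature e.
Proof.
rewrite {1}/curvature (@curvature_quad e _ 0 c); first by rewrite mul0r add0r.
by move=> a b /=; ring.
Qed.

Lemma curvature_Exp e k : curvature (Exp e k) =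
  (k * k.-1)%:R * eval e x ^+ k.-2 * slope e ^+ 2 + k%:R * eval e x ^+ k.-1 * curvature e.
Proof. by apply: curvature_quad => a b /=; rewrite natrM; ring. Qed.

Lemma curvature_Pow e r : curvature (Pow e r) =
  r * (r - 1) * eval e x `^ (r - 1 - 1) * slope e ^+ 2 + r * eval e x `^ (r - 1) * curvature e.
Proof. by apply: curvature_quad => a b /=; ring. Qed.

Lemma curvature_Sum k (f : 'I_k -> rexpr) : curvature (Sum f) = \sum_i curvature (f i).
Proof.
rewrite /curvature exchange_big/=; under [RHS]eq_bigr do rewrite exchange_big/=.
rewrite [RHS]exchange_big/=; apply: eq_bigr => b _.
rewrite [RHS]exchange_big/=; apply: eq_bigr => a _.
by rewrite mulr_sumr.
Qed.

Lemma gradient_slope (U : set 'rV[R]_m) e : open U -> (forall w, U w -> regular e w) -> U x ->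
  \sum_a v 0 a * gradient (eval e) x 0 a = slope e.
Proof.
move=> oU Ue Ux; have [_ E] := smooth_on_eval oU Ue.
by apply: eq_bigr => a _; rewrite mxE; congr (_ * _); exact: (E [:: a] x Ux).
Qed.

Lemma hessian_curvature (U : set 'rV[R]_m) e : open U -> (forall w, U w -> regular e w) -> U x ->
  (v *m hessian (eval e) x *m v^T) 0 0 = curvature e.
Proof.
move=> oU Ue Ux; have [_ E] := smooth_on_eval oU Ue.
have HE a b : hessian (eval e) x a b = eval (pdiff a (pdiff b e)) x.
  by rewrite mxE; exact: (E [:: a; b] x Ux).
rewrite mxE /curvature exchange_big/=; apply: eq_bigr => b _.
rewrite mxE [v^T b 0]mxE mulr_suml; apply: eq_bigr => a _.
by rewrite HE; ring.
Qed.

End jets.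

(** Lagrange's identity: twice the difference of the two sides is a sum of weighted squares. *)
Lemma weighted_cauchy_schwarz (R : realType) (I : finType) (s a b : I -> R) :
  (forall i, 0 <= s i) ->
  (\sum_i s i * (a i * b i)) ^+ 2 <= (\sum_i s i * a i ^+ 2) * (\sum_i s i * b i ^+ 2).
Proof.
move=> s0; set A := \sum_i s i * a i ^+ 2; set B := \sum_i s i * b i ^+ 2.
set C := \sum_i s i * (a i * b i).
have : 0 <= \sum_i \sum_k s i * s k * (a i * b k - a k * b i) ^+ 2.
  by apply: sumr_ge0 => i _; apply: sumr_ge0 => k _; apply: mulr_ge0; [exact: mulr_ge0|exact: sqr_ge0].
have -> : \sum_i \sum_k s i * s k * (a i * b k - a k * b i) ^+ 2 = A * B + B * A - 2 * (C * C).
  rewrite /A /B /C !mulr_suml mulr_sumr -!sumrN -!big_split/=; apply: eq_bigr => i _.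
  rewrite !mulr_sumr -!sumrN -!big_split/=; apply: eq_bigr => k _; ring.
rewrite expr2; lra.
Qed.

(** * The defining function of Omega_j *)

Section Omega_boundary.
Context {R : realType} {n : nat}.
Implicit Types (w x v : 'rV[R]_(n + n)).

Definition modulus2 (k : 'I_n) : @rexpr R (n + n) :=
  Add (Exp (Var (lshift n k)) 2) (Exp (Var (rshift n k)) 2).

Definition power_sum j := Sum (fun k => Exp (modulus2 k) j).

Definition norm2 := Sum modulus2.

Definition defining_expr j :=
  Add (Add (Pow (power_sum j) j%:R^-1) (Mul (Cst j%:R^-1) norm2)) (Cst (- 1)).

Lemma eval_power_sum j w : eval (power_sum j) w = \sum_k eval (modulus2 k) w ^+ j.
Proof. by []. Qed.

Lemma modulus2E k w : eval (modulus2 k) w = normc (toC w 0 k) ^+ 2.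
Proof. by rewrite sqr_normcE mxE. Qed.

Lemma modulus2_ge0 k w : 0 <= eval (modulus2 k) w.
Proof. by rewrite modulus2E sqr_ge0. Qed.

Lemma power_sum_ge0 j w : 0 <= eval (power_sum j) w.
Proof. by rewrite eval_power_sum sumr_ge0// => k _; rewrite exprn_ge0// modulus2_ge0. Qed.

Lemma F_eval j w : F n j (toC w) =
  eval (power_sum j) w `^ j%:R^-1 + j%:R^-1 * eval norm2 w.
Proof.
rewrite /F; congr (_ `^ _ + _ * _); apply: eq_bigr => k _.
  by rewrite exprM -modulus2E.
by rewrite -modulus2E.
Qed.

Lemma defining_exprE j w : eval (defining_expr j) w = F n j (toC w) - 1.
Proof. by rewrite F_eval. Qed.

Lemma powR_root_lt (s t : R) j : (0 < j)%N -> 0 <= s ->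
  (s `^ j%:R^-1 < t) = (0 < t) && (0 < t ^+ j - s).
Proof.
move=> j0 s0; have sE : s = (s `^ j%:R^-1) ^+ j.
  rewrite -powR_mulrn ?powR_ge0// -powRrM mulVf ?powRr1//.
  by rewrite pnatr_eq0 -lt0n.
rewrite [in RHS]sE subr_gt0; have := powR_ge0 s j%:R^-1; move: (s `^ _) => y y0.
apply/idP/andP => [yt|[t0]]; last by rewrite ltr_pXn2r ?nnegrE// ltW.
have t0 := le_lt_trans y0 yt; split => //.
by rewrite ltr_pXn2r ?nnegrE// ltW.
Qed.

Lemma open_eval_gt0 (e : @rexpr R (n + n)) : (forall w, regular e w) ->
  open [set w | 0 < eval e w].
Proof.
move=> re; have ce : continuous (eval e) by move=> w; exact: continuous_eval.
have -> : [set w | 0 < eval e w] = eval e @^-1` [set y | 0 < y] by [].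
by apply: open_comp => [w _|]; [exact: ce|exact: open_gt].
Qed.

(** At the origin the j-th root is not a regular expression, so F < 1 is restated by two polynomial
    inequalities: with t = 1 - |z|^2 / j, both t > 0 and t^j > S. *)
Lemma open_realify_Omega j : (0 < j)%N -> open (realify (Omega R n j)).
Proof.
move=> j0; pose e1 := Add (Cst 1) (Mul (Cst (- j%:R^-1)) norm2).
pose e2 := Add (Exp e1 j) (Mul (Cst (- 1)) (power_sum j)).
have -> : realify (Omega R n j) = [set w | 0 < eval e1 w] `&` [set w | 0 < eval e2 w].
  apply/seteqP; split => w; rewrite /realify /Omega /= -/(eval norm2 w) -/(eval (power_sum j) w)
    F_eval -ltrBrDr powR_root_lt ?power_sum_ge0// mulN1r mulNr; by move=> /andP.
by apply: openI; apply: open_eval_gt0 => w /=; intuition.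
Qed.

Lemma F_eq0 j w : (0 < j)%N -> eval (power_sum j) w = 0 -> F n j (toC w) = 0.
Proof.
move=> j0 S0; rewrite F_eval S0 powR0 ?invr_eq0 ?pnatr_eq0 -?lt0n// add0r.
rewrite [eval norm2 w]big1 ?mulr0// => k _; apply/eqP.
move/eqP: S0; rewrite eval_power_sum psumr_eq0 => [|i _]; last by rewrite exprn_ge0// modulus2_ge0.
by move=> /allP /(_ k); rewrite mem_index_enum expf_eq0 j0 => /(_ isT).
Qed.

(** For j > 0, the complement of the origin. There the root is smooth, and this one set serves as
    the neighbourhood of every boundary point. *)
Definition punctured j := [set w | 0 < eval (power_sum j) w].

Lemma open_punctured j : open (punctured j).
Proof. by apply: open_eval_gt0 => w /=; intuition. Qed.

Lemma regular_defining_expr j w : punctured j w -> regular (defining_expr j) w.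
Proof. by rewrite /punctured/= => S0; intuition. Qed.

Lemma boundary_Omega j w : (0 < j)%N -> boundary (realify (Omega R n j)) w ->
  F n j (toC w) = 1 /\ punctured j w.
Proof.
move=> j0 [cw]; have := open_realify_Omega j0; rewrite interior_id => ->.
rewrite /realify /Omega/= => /negP; rewrite -leNgt => F1.
have pw : punctured j w.
  rewrite /punctured/= lt_neqAle power_sum_ge0 andbT eq_sym.
  by apply/eqP => /(F_eq0 j0) F0; move: F1; rewrite F0 ler10.
split=> //; apply/eqP; rewrite eq_le F1 andbT leNgt; apply/negP => F1'.
have r0 : 0 < eval (defining_expr j) w by rewrite defining_exprE subr_gt0.
have /cvgr_gt /(_ _ r0) near_r := continuous_eval (regular_defining_expr pw).
have [y [Dy ry]] := cw _ near_r.
have : 0 < eval (defining_expr j) y by exact: ry.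
by rewrite defining_exprE subr_gt0; move: Dy => /lt_trans /[apply]; rewrite ltxx.
Qed.

Lemma slope_modulus2 x v k : slope x v (modulus2 k) =
  2 * (x 0 (lshift n k) * v 0 (lshift n k) + x 0 (rshift n k) * v 0 (rshift n k)).
Proof. by rewrite slope_Add !slope_Exp !slope_Var /=; ring. Qed.

Lemma curvature_modulus2 x v k : curvature x v (modulus2 k) =
  2 * (v 0 (lshift n k) ^+ 2 + v 0 (rshift n k) ^+ 2).
Proof. by rewrite curvature_Add !curvature_Exp !curvature_Var !slope_Var /=; ring. Qed.

(** Euler's identity, F being homogeneous of degree 2. It shows that the gradient does not vanish
    where F = 1. *)
Lemma slope_defining_expr j x : (0 < j)%N -> punctured j x ->
  slope x x (defining_expr j) = 2 * F n j (toC x).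
Proof.
move=> j0 px; have j0' : j%:R != 0 :> R by rewrite pnatr_eq0 -lt0n.
have mE k : slope x x (modulus2 k) = 2 * eval (modulus2 k) x.
  by rewrite slope_modulus2 /=; ring.
have SE : slope x x (power_sum j) = 2 * j%:R * eval (power_sum j) x.
  rewrite slope_Sum eval_power_sum mulr_sumr; apply: eq_bigr => k _.
  rewrite slope_Exp mE; move: (eval (modulus2 k) x) => y.
  by rewrite -[in y ^+ j](prednK j0) exprSr; ring.
have NE : slope x x norm2 = 2 * eval norm2 x.
  by rewrite slope_Sum mulr_sumr; apply: eq_bigr => k _.
rewrite /defining_expr !slope_Add slope_scale slope_Pow slope_Cst SE NE F_eval.
have -> : eval (power_sum j) x `^ j%:R^-1 = eval (power_sum j) x `^ (j%:R^-1 - 1) * eval (power_sum j) x.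
  rewrite -[X in _ * X]powRr1 ?power_sum_ge0// -powRD ?subrK//.
  by apply/implyP => _; rewrite gt_eqF.
by field.
Qed.

(* Q(S^(1/j)) = (1/j) S^(1/j-2) (S Q(S) - (1-1/j) G(S)^2) where G, Q are the first and second
   derivatives in the direction v; the parenthesis is nonnegative by Cauchy-Schwarz. *)
Lemma curvature_Pow_power_sum_ge0 j x v : (2 <= j)%N -> punctured j x ->
  0 <= curvature x v (Pow (power_sum j) j%:R^-1).
Proof.
move=> j2 px; have j0 : (0 < j)%N by exact: leq_trans j2.
have jr0 : 0 < j%:R :> R by rewrite ltr0n.
have jE : j = j.-2.+2 by case: j j2 {px j0 jr0} => [|[|]].
set S := eval (power_sum j) x.
rewrite curvature_Pow -/S; set T := S `^ (j%:R^-1 - 1 - 1).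
have T0 : 0 <= T by exact: powR_ge0.
have -> : S `^ (j%:R^-1 - 1) = T * S.
  rewrite -[X in _ * X]powRr1 ?power_sum_ge0// -powRD ?subrK//.
  by apply/implyP => _; rewrite gt_eqF.
(* Writing the j-th power as weight times square brings S and the derivative of the power sum to the
   form of Cauchy-Schwarz, with weights |z_k|^(2(j-2)). *)
pose s k := eval (modulus2 k) x ^+ j.-2.
pose m k := eval (modulus2 k) x; pose g k := slope x v (modulus2 k).
have s0 k : 0 <= s k by rewrite exprn_ge0// modulus2_ge0.
have SE : S = \sum_k s k * m k ^+ 2.
  by rewrite /S eval_power_sum; apply: eq_bigr => k _; rewrite /s /m {1}jE -exprD addn2.
have m1 k : eval (modulus2 k) x ^+ j.-1 = s k * m k.
  by rewrite {1}jE /= exprSr.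
have GE : slope x v (power_sum j) = j%:R * \sum_k s k * (m k * g k).
  rewrite slope_Sum mulr_sumr; apply: eq_bigr => k _.
  by rewrite slope_Exp m1 /g; ring.
(* The discarded terms contain the second derivatives of |z_k|^2, which are nonnegative. *)
have QE : (j * j.-1)%:R * \sum_k s k * g k ^+ 2 <= curvature x v (power_sum j).
  rewrite curvature_Sum mulr_sumr; apply: ler_sum => k _.
  rewrite curvature_Exp -/(s k) m1 -/(g k) mulrA lerDl.
  rewrite mulr_ge0 ?mulr_ge0// ?modulus2_ge0// curvature_modulus2.
  by rewrite mulr_ge0// addr_ge0// sqr_ge0.
have CS := weighted_cauchy_schwarz m g s0.
have -> : j%:R^-1 * (j%:R^-1 - 1) * T * slope x v (power_sum j) ^+ 2 +
    j%:R^-1 * (T * S) * curvature x v (power_sum j) =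
  j%:R^-1 * T * (S * curvature x v (power_sum j) - (1 - j%:R^-1) * slope x v (power_sum j) ^+ 2).
  by ring.
apply: mulr_ge0; first by rewrite mulr_ge0// invr_ge0 ltW.
rewrite subr_ge0.
have S0 : 0 <= S by exact: power_sum_ge0.
apply: le_trans (ler_wpM2l S0 QE).
have -> : (1 - j%:R^-1) * slope x v (power_sum j) ^+ 2 =
    (j * j.-1)%:R * (\sum_k s k * (m k * g k)) ^+ 2.
  rewrite GE natrM -subn1 natrB//; field; exact: lt0r_neq0.
by rewrite [leRHS]mulrCA ler_wpM2l// SE.
Qed.

Lemma curvature_defining_expr_gt0 j x v : (2 <= j)%N -> punctured j x -> v != 0 ->
  0 < curvature x v (defining_expr j).
Proof.
move=> j2 px v0; rewrite /defining_expr !curvature_Add curvature_scale curvature_Cst addr0.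
rewrite ltr_wpDl ?curvature_Pow_power_sum_ge0// mulr_gt0 ?invr_gt0 ?ltr0n//; first exact: leq_trans j2.
rewrite curvature_Sum lt_neqAle; apply/andP; split; last first.
  by apply: sumr_ge0 => k _; rewrite curvature_modulus2 mulr_ge0// addr_ge0// sqr_ge0.
apply: contra v0; rewrite eq_sym psumr_eq0; last first.
  by move=> k _; rewrite curvature_modulus2 mulr_ge0// addr_ge0// sqr_ge0.
move=> /allP H; apply/eqP/rowP => a; rewrite mxE.
have K k : v 0 (lshift n k) = 0 /\ v 0 (rshift n k) = 0.
  have := H k; rewrite mem_index_enum curvature_modulus2 => /(_ isT).
  rewrite mulf_eq0 pnatr_eq0/= paddr_eq0 ?sqr_ge0// !sqrf_eq0.
  by move=> /andP[/eqP -> /eqP ->].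
by case: (split_ordP a) => k ->; have [] := K k.
Qed.

Lemma strongly_convex_Omega j : (2 <= j)%N -> strongly_convex (realify (Omega R n j)).
Proof.
move=> j2 p bp; have j0 : (0 < j)%N by exact: leq_trans j2.
have [_ pp] := boundary_Omega j0 bp.
exists (punctured j), (eval (defining_expr j)); split => //.
- exact: open_punctured.
- split.
  + by have [] := smooth_on_eval (@open_punctured j) (@regular_defining_expr j).
  + have E w : (realify (Omega R n j)) w = (eval (defining_expr j) w < 0) :> Prop.
      by rewrite defining_exprE subr_lt0.
    by apply/seteqP; split => w; rewrite /setI/= E; case.
  + move=> x bx px; apply/eqP => gx.
    have [F1 _] := boundary_Omega j0 bx.
    have := gradient_slope x (@open_punctured j) (@regular_defining_expr j) px.
    rewrite gx slope_defining_expr// F1 big1; first by lra.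
    by move=> a _; rewrite mxE mulr0.
- move=> x px v v0.
  rewrite (hessian_curvature v (@open_punctured j) (@regular_defining_expr j) px).
  exact: curvature_defining_expr_gt0.
Qed.

Lemma smooth_boundary_Omega j : (2 <= j)%N -> smooth_boundary (realify (Omega R n j)).
Proof.
by move=> j2 p /(strongly_convex_Omega j2)[U [r [oU Up dU _]]]; exists U, r.
Qed.

End Omega_boundary.

(** * Omega_j is a bounded domain *)

Section Omega_domain.
Context {R : realType} {n : nat}.

Lemma continuous_Re : continuous (@complex.Re R : R[i] -> R).
Proof.
move=> z; apply/(@cvgrPdist_lt _ _ _ _ (nbhs_filter z)) => e e0.
exists e%:C => /=; first by rewrite ltcR.
move=> w; rewrite /ball/= normc_lt => zw; apply: le_lt_trans zw.
by apply: le_trans (normRe_le _); case: (z) => ? ?; case: (w) => ? ?.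
Qed.

Lemma continuous_Im : continuous (@complex.Im R : R[i] -> R).
Proof.
move=> z; apply/(@cvgrPdist_lt _ _ _ _ (nbhs_filter z)) => e e0.
exists e%:C => /=; first by rewrite ltcR.
move=> w; rewrite /ball/= normc_lt => zw; apply: le_lt_trans zw.
by apply: le_trans (normIm_le _); case: (z) => ? ?; case: (w) => ? ?.
Qed.

Lemma continuous_real_complex : continuous (real_complex R : R -> R[i]).
Proof.
move=> x; apply/cvgrPdist_lt => e' e'0; have [-> e0] := gt0_complexE e'0.
exists (complex.Re e') => //= y; rewrite /ball/= => xy.
by rewrite normc_lt normc_realB.
Qed.

(** Openness was proved in real coordinates; this continuous map carries it back to C^n. *)
Definition toR (z : 'rV[R[i]]_n) : 'rV[R]_(n + n) :=
  \row_a match fintype.split a with inl k => complex.Re (z 0 k) | inr k => complex.Im (z 0 k) end.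

Lemma toRK z : toC (toR z) = z.
Proof.
apply/rowP => k; rewrite !mxE -[lshift n k]/(unsplit (inl k)) -[rshift n k]/(unsplit (inr k)).
by rewrite !fintype.unsplitK; case: (z 0 k).
Qed.

Lemma continuous_toR : continuous toR.
Proof.
move=> z; apply: (mx_cvg_entries (nbhs_filter z)) => i a.
rewrite (_ : (fun x => toR x i a) = fun x : 'rV[R[i]]_n =>
  match fintype.split a with inl k => complex.Re (x 0 k) | inr k => complex.Im (x 0 k) end); last first.
  by apply/funext => x; rewrite mxE.
rewrite mxE; case: (fintype.split a) => k.
- apply: (@continuous_comp _ _ _ (fun M : 'rV[R[i]]_n => M 0 k) (@complex.Re R)).
    exact: coord_continuous.
  exact: continuous_Re.
- apply: (@continuous_comp _ _ _ (fun M : 'rV[R[i]]_n => M 0 k) (@complex.Im R)).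
    exact: coord_continuous.
  exact: continuous_Im.
Qed.

Lemma open_Omega j : (0 < j)%N -> open (Omega R n j).
Proof.
move=> j0; have -> : Omega R n j = toR @^-1` realify (Omega R n j).
  by apply/seteqP; split => z; rewrite /realify /= toRK.
by apply: open_comp => [z _|]; [exact: continuous_toR|exact: open_realify_Omega].
Qed.

Lemma F_scale j (t : R) (z : 'rV[R[i]]_n) : (0 < j)%N -> F n j (t%:C *: z) = t ^+ 2 * F n j z.
Proof.
move=> j0; have tz k : normc ((t%:C *: z) 0 k) ^+ 2 = t ^+ 2 * normc (z 0 k) ^+ 2.
  by rewrite mxE normcM normc_real exprMn real_normK ?num_real.
rewrite /F mulrDr; congr (_ + _).
  set S := \sum_k normc (z 0 k) ^+ (2 * j).
  have S0 : 0 <= S by apply: sumr_ge0 => k _; rewrite exprn_ge0 ?normc_ge0.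
  have -> : t ^+ 2 * S `^ j%:R^-1 = ((t ^+ 2) ^+ j * S) `^ j%:R^-1.
    by rewrite [RHS]powRM; [rewrite powR_root ?sqr_ge0|rewrite exprn_ge0 ?sqr_ge0|].
  congr (_ `^ _); rewrite mulr_sumr; apply: eq_bigr => k _.
  by rewrite !exprM tz exprMn.
by rewrite mulrCA; congr (_ * _); rewrite mulr_sumr; apply: eq_bigr => k _.
Qed.

Lemma F_ge0 j (z : 'rV[R[i]]_n) : 0 <= F n j z.
Proof.
by rewrite addr_ge0 ?powR_ge0// mulr_ge0 ?invr_ge0// sumr_ge0// => k _; rewrite sqr_ge0.
Qed.

Lemma Omega0 j : (0 < j)%N -> Omega R n j 0.
Proof.
by move=> j0; rewrite /Omega/= -(scale0r 0) -(rmorph0 (real_complex R)) F_scale// expr0n mul0r.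
Qed.

(** By homogeneity the domain is star-shaped about 0, hence a union of segments through 0. *)
Lemma connected_Omega j : (0 < j)%N -> connected (Omega R n j).
Proof.
move=> j0; pose ray (z : 'rV[R[i]]_n) := (fun t : R => t%:C *: z) @` `[0, 1].
have -> : Omega R n j = \bigcup_(z in Omega R n j) ray z.
  apply/seteqP; split => z.
    by move=> Oz; exists z => //; exists 1; rewrite ?scale1r//= in_itv/= lexx ler01.
  move=> [w Ow [t /=]]; rewrite in_itv/= => /andP[t0 t1] <-.
  rewrite /Omega/= F_scale//; apply: le_lt_trans Ow; rewrite ler_piMl ?expr_le1//.
  exact: F_ge0.
apply: bigcup_connected.
  exists 0 => z _; exists 0; last by rewrite scale0r.
  by rewrite /= in_itv/= lexx ler01.
move=> z _; apply: connected_continuous_connected; first exact: segment_connected.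
apply: continuous_subspaceT => t.
apply: (mx_cvg_entries (nbhs_filter t)) => i k.
rewrite (_ : (fun x : R => _) = (fun x : R => x%:C * z i k)); last by apply/funext => x; rewrite mxE.
rewrite mxE; apply: cvgM; [exact: continuous_real_complex|exact: cvg_cst].
Qed.

Lemma domain_Omega j : (0 < j)%N -> domain (Omega R n j).
Proof.
move=> j0; split; [by exists 0; exact: Omega0|exact: open_Omega|exact: connected_Omega].
Qed.

Lemma bounded_Omega j : (0 < j)%N -> bounded_set (Omega R n j).
Proof.
move=> j0; exists 1; split; first exact: real1.
move=> M M1 z Oz; apply: (le_trans _ (ltW M1)); apply: normr_row_le => // p.
by have := Omega_polydisc p j0 Oz; rewrite -normc_lt1 => /ltW.
Qed.

End Omega_domain.

Unset Implicit Arguments.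

Theorem mainTheorem5 (R : realType) (n : nat) (hn : (2 <= n)%N) :
  (forall j : nat, (2 <= j)%N ->
     [/\ domain (Omega R n j),
         bounded_set (Omega R n j),
         smooth_boundary (realify (Omega R n j)) &
         strongly_convex (realify (Omega R n j))]) /\
  (fun j : nat =>
     hyperbolicity_constant (Omega R n j) (kobayashi_dist (Omega R n j)))
    @ \oo --> +oo%E.
Proof.
split; last exact: hyperbolicity_constant_Omega_cvg.
move=> j j2; have j0 : (0 < j)%N by exact: leq_trans j2.
split; [exact: domain_Omega|exact: bounded_Omega|exact: smooth_boundary_Omega|exact: strongly_convex_Omega].
Qed.
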